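(* For each $b\ge1$ there exists a torus of revolution $T_b$ such that its conformal class is $\omega(T_b)=ib$ and $\mathcal{W}(T_b)<8\pi$.
   Context: $\mathbb{S}^1=\mathbb{R}/\mathbb{Z}$, $\mathbb{H}^2=\mathbb{R}\times(0,\infty)$. A torus of revolution is an immersion $F_\gamma:\mathbb{S}^1\times\mathbb{S}^1\to\mathbb{R}^3$ of the form $F_\gamma(u,v)=(\gamma^{(1)}(u),\gamma^{(2)}(u)\cos(2\pi v),\gamma^{(2)}(u)\sin(2\pi v))$ with an immersed curve $\gamma=(\gamma^{(1)},\gamma^{(2)})\in C^\infty(\mathbb{S}^1,\mathbb{H}^2)$. The Willmore energy of a smooth immersion $f$ of a surface $\Sigma$ is $\mathcal{W}(f)=\frac14\int_\Sigma|\vec H|^2d\mu$, with $\vec H$ the mean curvature vector (trace, i.e. sum of principal curvatures times unit normal) and $\mu$ the induced measure. Conformal class: for a smooth torus $S$ in $\mathbb{R}^3$ there is a unique $\omega=\omega(S)\in\mathbb{C}$ with $|\omega|\ge1$, $\operatorname{Im}(\omega)>0$, $\operatorname{Re}(\omega)\in[0,\frac12]$ such that $S$ admits a smooth conformal parametrization $F:\mathbb{C}/(\mathbb{Z}+\omega\mathbb{Z})\to S$, i.e. the induced metric satisfies $g^F_{i,j}=e^{2u}\delta_{i,j}$ for some $u\in C^\infty(\mathbb{C}/(\mathbb{Z}+\omega\mathbb{Z}))$. For an immersed torus given by $F_\gamma$, a parametrization means $F=F_\gamma\circ\Phi$ with $\Phi:\mathbb{C}/(\mathbb{Z}+\omega\mathbb{Z})\to\mathbb{S}^1\times\mathbb{S}^1$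 a diffeomorphism. *)

(* Defs.v *)
From Stdlib Require Import Reals.
From Coquelicot Require Import Coquelicot.

Open Scope R_scope.

Definition smooth1 (f : R -> R) : Prop :=
  forall n x, ex_derive_n f n x.

(* [ex_diff_n f n x y]: all iterated partial derivatives of order at most [n]
   exist and are continuous at [(x, y)]. *)
Definition smooth (f : R * R -> R) : Prop :=
  forall n x y, ex_diff_n (fun x y => f (x, y)) n x y.

Definition smooth_map2 (f : R * R -> R * R) : Prop :=
  smooth (fun p => fst (f p)) /\ smooth (fun p => snd (f p)).

Definition R3 : Type := (R * R * R)%type.

Definition px (a : R3) : R := fst (fst a).
Definition py (a : R3) : R := snd (fst a).
Definition pz (a : R3) : R := snd a.

Definition smooth_map3 (f : R * R -> R3) : Prop :=
  smooth (fun p => px (f p)) /\ smooth (fun p => py (f p)) /\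
  smooth (fun p => pz (f p)).

Definition dot (a b : R3) : R := px a * px b + py a * py b + pz a * pz b.

Definition cross (a b : R3) : R3 :=
  (py a * pz b - pz a * py b,
   pz a * px b - px a * pz b,
   px a * py b - py a * px b).

Definition scal3 (k : R) (a : R3) : R3 := (k * px a, k * py a, k * pz a).

Definition norm3 (a : R3) : R := sqrt (dot a a).

Definition d1 (f : R * R -> R) (p : R * R) : R :=
  Derive (fun x => f (x, snd p)) (fst p).
Definition d2 (f : R * R -> R) (p : R * R) : R :=
  Derive (fun y => f (fst p, y)) (snd p).

Definition D1 (f : R * R -> R3) (p : R * R) : R3 :=
  (d1 (fun q => px (f q)) p, d1 (fun q => py (f q)) p, d1 (fun q => pz (f q)) p).
Definition D2 (f : R * R -> R3) (p : R * R) : R3 :=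
  (d2 (fun q => px (f q)) p, d2 (fun q => py (f q)) p, d2 (fun q => pz (f q)) p).

Definition g11 (f : R * R -> R3) (p : R * R) : R := dot (D1 f p) (D1 f p).
Definition g12 (f : R * R -> R3) (p : R * R) : R := dot (D1 f p) (D2 f p).
Definition g22 (f : R * R -> R3) (p : R * R) : R := dot (D2 f p) (D2 f p).

Definition detg (f : R * R -> R3) (p : R * R) : R :=
  g11 f p * g22 f p - g12 f p * g12 f p.

Definition unit_normal (f : R * R -> R3) (p : R * R) : R3 :=
  scal3 (/ norm3 (cross (D1 f p) (D2 f p))) (cross (D1 f p) (D2 f p)).

Definition h11 (f : R * R -> R3) (p : R * R) : R :=
  dot (D1 (D1 f) p) (unit_normal f p).
Definition h12 (f : R * R -> R3) (p : R * R) : R :=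
  dot (D1 (D2 f) p) (unit_normal f p).
Definition h22 (f : R * R -> R3) (p : R * R) : R :=
  dot (D2 (D2 f) p) (unit_normal f p).

(* Sum of the principal curvatures, i.e. the trace of [g^-1 h] (no factor 1/2). *)
Definition mean_curvature (f : R * R -> R3) (p : R * R) : R :=
  (h11 f p * g22 f p - 2 * (h12 f p * g12 f p) + h22 f p * g11 f p) / detg f p.

Definition mean_curvature_vector (f : R * R -> R3) (p : R * R) : R3 :=
  scal3 (mean_curvature f p) (unit_normal f p).

(* A map on S^1 x S^1 = R^2 / Z^2 is a map on R^2 that is 1-periodic in each
   variable. *)
Definition immersed_torus (f : R * R -> R3) : Prop :=
  smooth_map3 f /\
  (forall u v, f (u + 1, v) = f (u, v)) /\
  (forall u v, f (u, v + 1) = f (u, v)) /\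
  (forall p, cross (D1 f p) (D2 f p) <> (0, 0, 0)).

(* [0,1]^2 is a fundamental domain of S^1 x S^1, and [sqrt (detg f)] is the
   density of the measure induced by [f]. *)
Definition willmore_energy (f : R * R -> R3) : R :=
  1 / 4 *
  RInt (fun u =>
    RInt (fun v =>
      Rsqr (norm3 (mean_curvature_vector f (u, v))) * sqrt (detg f (u, v)))
      0 1)
    0 1.

Definition immersed_closed_curve_H2 (gamma : R -> R * R) : Prop :=
  smooth1 (fun u => fst (gamma u)) /\
  smooth1 (fun u => snd (gamma u)) /\
  (forall u, gamma (u + 1) = gamma u) /\
  (forall u, 0 < snd (gamma u)) /\
  (forall u, (Derive (fun t => fst (gamma t)) u,
              Derive (fun t => snd (gamma t)) u) <> (0, 0)).

Definition revolve (gamma : R -> R * R) (p : R * R) : R3 :=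
  (fst (gamma (fst p)),
   snd (gamma (fst p)) * cos (2 * PI * snd p),
   snd (gamma (fst p)) * sin (2 * PI * snd p)).

Definition torus_of_revolution (f : R * R -> R3) : Prop :=
  immersed_torus f /\
  exists gamma, immersed_closed_curve_H2 gamma /\ forall p, f p = revolve gamma p.

Definition cong_lattice (omega z w : C) : Prop :=
  exists m n : Z, w = (z + (RtoC (IZR m) + RtoC (IZR n) * omega))%C.

Definition cong_Z2 (p q : R * R) : Prop :=
  exists m n : Z, q = (fst p + IZR m, snd p + IZR n).

(* Diffeomorphisms C / (Z + omega Z) -> R^2 / Z^2, given by lifts to the
   universal covers: [Phi] and [Psi] are smooth, pass to the quotients, and
   induce mutually inverse maps there. *)
Definition torus_diffeo (omega : C) (Phi : C -> R * R) : Prop :=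
  smooth_map2 Phi /\
  (forall z w, cong_lattice omega z w -> cong_Z2 (Phi z) (Phi w)) /\
  exists Psi : R * R -> C,
    smooth_map2 Psi /\
    (forall p q, cong_Z2 p q -> cong_lattice omega (Psi p) (Psi q)) /\
    (forall z, cong_lattice omega z (Psi (Phi z))) /\
    (forall p, cong_Z2 p (Phi (Psi p))).

Definition conformal_parametrization
  (omega : C) (f : R * R -> R3) (F : C -> R3) : Prop :=
  smooth_map3 F /\
  (exists Phi, torus_diffeo omega Phi /\ forall z, F z = f (Phi z)) /\
  exists u : C -> R,
    smooth u /\
    (forall z w, cong_lattice omega z w -> u z = u w) /\
    (forall z, g11 F z = exp (2 * u z) /\ g22 F z = exp (2 * u z) /\
               g12 F z = 0).

(* By uniformization, exactly one [omega] satisfies this for an immersed torus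
   [f], so the relation says "omega is the conformal class of f" without a
   choice operator. *)
Definition is_conformal_class (f : R * R -> R3) (omega : C) : Prop :=
  1 <= Cmod omega /\ 0 < Im omega /\ 0 <= Re omega <= 1 / 2 /\
  exists F, conformal_parametrization omega f F.

(* Main.v *)
(* In hyperbolic arclength [s] a profile in the half-plane has Euclidean tangent
   angle [Phi] and hyperbolic curvature [kappa = Phi' + cos Phi]; the torus is
   conformal to a rectangle whose side ratio is the hyperbolic length over
   [2 PI], and its Willmore energy is [PI / 2] times the integral of
   [(Phi' - cos Phi)^2], which equals that of [kappa^2] because the difference
   [4 (sin Phi)'] integrates to zero.  So one needs a smooth closed curve of
   length [4 l = 2 PI b] whose elastic energy is less than 16.

   A curve that is symmetric under reflection in two orthogonal geodesics is
   made of four congruent quarters of length [l].  In Fermi coordinates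
   [(p, rho)] along one of them, with [chi] the angle to the [rho]-direction,
   it solves [rho' = cos chi], [p' = sin chi / cosh rho], and every function
   [chi'] that is even about [0] and about [l] and has integral [PI / 2] over
   [[0, l]] gives a curve that closes.  The catenary [y = cosh x] has curvature
   [2 / cosh s] in hyperbolic arclength; following it up to a suitable [s0] and
   then its tangent geodesic gives a quarter of energy [4 tanh s0 < 4].  Its rate
   [chi'] jumps at [s0]; a Bernstein polynomial in [sin^2 (PI s / (2 l))],
   corrected by a constant, is close to it away from [s0] and bounded near [s0],
   so its energy is still less than 4. *)

Require Import Defs.
From Stdlib Require Import Reals.
From Coquelicot Require Import Coquelicot.
From Stdlib Require Import Lia Psatz ZArith.

Open Scope R_scope.

(** * Smooth functions of one variable *)

(** Differentiability [n] times, peeling off the innermost derivative, whereas [Derive_n] adds the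
    outermost one. In this form the closure properties follow by induction on [n] with the function
    generalized. *)
Fixpoint Cn (n : nat) (f : R -> R) : Prop :=
  match n with
  | O => True
  | S m => (forall x, ex_derive f x) /\ Cn m (Derive f)
  end.

Lemma Cn_ext n : forall f g, (forall x, f x = g x) -> Cn n f -> Cn n g.
Proof.
induction n as [|n IH]; intros f g E; simpl; [easy|].
intros [Df Hf]; split.
- intro x; apply (ex_derive_ext f); [exact E | apply Df].
- apply (IH (Derive f)); [|exact Hf].
  intro x; now apply Derive_ext.
Qed.

Lemma Cn_step n f : Cn (S n) f -> Cn n f.
Proof.
revert f; induction n as [|n IH]; intros f; [easy|].
intros [Df Hf]; split; [exact Df | now apply IH].
Qed.

Lemma Cn_of_derive n f g :
  (forall x, is_derive f x (g x)) -> Cn n g -> Cn (S n) f.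
Proof.
intros D Hg; split.
- intro x; now exists (g x).
- apply (Cn_ext n g); [|exact Hg].
  intro x; symmetry; now apply is_derive_unique.
Qed.

Lemma Derive_n_shift f n x : Derive_n f (S n) x = Derive_n (Derive f) n x.
Proof.
change (Derive_n (Derive f) n x) with (Derive_n (Derive_n f 1) n x).
now rewrite (Derive_n_comp f n 1 x), Nat.add_comm.
Qed.

Lemma smooth1_Derive f : smooth1 f -> smooth1 (Derive f).
Proof.
intros Hf [|n] x; [exact I|].
simpl; apply (ex_derive_ext (Derive_n f (S n))).
- intro t; apply Derive_n_shift.
- exact (Hf (S (S n)) x).
Qed.

Lemma smooth1_ex_derive f x : smooth1 f -> ex_derive f x.
Proof. intro Hf; exact (Hf 1%nat x). Qed.

Lemma smooth1_is_derive f x : smooth1 f -> is_derive f x (Derive f x).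
Proof. intro Hf; now apply Derive_correct, smooth1_ex_derive. Qed.

Lemma smooth1_continuous f x : smooth1 f -> continuous f x.
Proof.
intro Hf; apply (ex_derive_continuous f x), (smooth1_ex_derive f x Hf).
Qed.

Lemma smooth1_Cn f : smooth1 f <-> forall n, Cn n f.
Proof.
split.
- intros Hf n; revert f Hf; induction n as [|n IH]; intros f Hf; [exact I|].
  split.
  + intro x; now apply smooth1_ex_derive.
  + now apply IH, smooth1_Derive.
- intros H [|n]; [easy|].
  generalize (H (S n)); clear H; revert f.
  induction n as [|n IH]; intros f H x; [apply (proj1 H)|].
  destruct H as [_ H].
  apply (ex_derive_ext (Derive_n (Derive f) n)); [|now apply (IH (Derive f) H)].
  intro t; symmetry; apply Derive_n_shift.
Qed.

Lemma smooth1_ext f g : (forall x, f x = g x) -> smooth1 f -> smooth1 g.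
Proof.
rewrite 2!smooth1_Cn; intros E H n; now apply (Cn_ext n f).
Qed.

Lemma smooth1_of_derive f g :
  (forall x, is_derive f x (g x)) -> smooth1 g -> smooth1 f.
Proof.
rewrite 2!smooth1_Cn; intros D H n; apply Cn_step.
now apply (Cn_of_derive n f g).
Qed.

Lemma smooth1_const a : smooth1 (fun _ => a).
Proof.
apply smooth1_Cn; intro n; revert a; induction n as [|n IH]; intro a; [easy|].
apply (Cn_of_derive n _ (fun _ => 0)); [|apply IH].
intro x; auto_derive; [easy | ring].
Qed.

Lemma smooth1_id : smooth1 (fun x => x).
Proof.
apply (smooth1_of_derive _ (fun _ => 1)); [|apply smooth1_const].
intro x; auto_derive; [easy | ring].
Qed.

Lemma Cn_plus n f g : Cn n f -> Cn n g -> Cn n (fun x => f x + g x).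
Proof.
revert f g; induction n as [|n IH]; intros f g; [easy|].
intros [Df Hf] [Dg Hg].
apply (Cn_of_derive n _ (fun x => Derive f x + Derive g x)); [|now apply IH].
intro x; apply (is_derive_plus f g x); now apply Derive_correct.
Qed.

Lemma Cn_mult n f g : Cn n f -> Cn n g -> Cn n (fun x => f x * g x).
Proof.
revert f g; induction n as [|n IH]; intros f g; [easy|].
intros Sf Sg; generalize (Cn_step n f Sf) (Cn_step n g Sg); intros Tf Tg.
destruct Sf as [Df Hf], Sg as [Dg Hg].
apply (Cn_of_derive n _ (fun x => Derive f x * g x + f x * Derive g x)).
- intro x; apply (is_derive_mult f g x); try now apply Derive_correct.
  intros a b; apply Rmult_comm.
- now apply Cn_plus; apply IH.
Qed.

Lemma smooth1_plus f g :
  smooth1 f -> smooth1 g -> smooth1 (fun x => f x + g x).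
Proof. rewrite 3!smooth1_Cn; intros Hf Hg n; now apply Cn_plus. Qed.

Lemma smooth1_mult f g :
  smooth1 f -> smooth1 g -> smooth1 (fun x => f x * g x).
Proof. rewrite 3!smooth1_Cn; intros Hf Hg n; now apply Cn_mult. Qed.

Lemma smooth1_scal a f : smooth1 f -> smooth1 (fun x => a * f x).
Proof. apply (smooth1_mult (fun _ => a)), smooth1_const. Qed.

Lemma smooth1_minus f g :
  smooth1 f -> smooth1 g -> smooth1 (fun x => f x - g x).
Proof.
intros Hf Hg; apply (smooth1_ext (fun x => f x + -1 * g x)).
- intro x; ring.
- apply smooth1_plus, smooth1_scal; assumption.
Qed.

Lemma smooth1_comp f g :
  smooth1 f -> smooth1 g -> smooth1 (fun x => f (g x)).
Proof.
intros Hf Hg; apply smooth1_Cn; intro n; revert f Hf.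
induction n as [|n IH]; intros f Hf; [easy|].
apply (Cn_of_derive n _ (fun x => Derive g x * Derive f (g x))).
- intro x.
  apply (is_derive_comp f g x); now apply smooth1_is_derive.
- apply Cn_mult; [|now apply IH, smooth1_Derive].
  now apply smooth1_Cn, smooth1_Derive.
Qed.

(** The derivative is the product of [- f'] with two copies of [/ f], so the order reached for [/ f]
    raises itself by one. *)
Lemma smooth1_inv f :
  (forall x, f x <> 0) -> smooth1 f -> smooth1 (fun x => / f x).
Proof.
intros Nf Hf; apply smooth1_Cn; intro n.
induction n as [|n IH]; [easy|].
apply (Cn_of_derive n _ (fun x => (-1 * Derive f x) * (/ f x * / f x))).
- intro x; replace (_ * _) with (- Derive f x / f x ^ 2) by (field; apply Nf).
  apply is_derive_inv; [now apply smooth1_is_derive | apply Nf].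
- repeat apply Cn_mult; try exact IH.
  + apply smooth1_Cn, smooth1_const.
  + now apply smooth1_Cn, smooth1_Derive.
Qed.

Lemma smooth1_exp : smooth1 exp.
Proof.
apply smooth1_Cn; intro n; induction n as [|n IH]; [easy|].
apply (Cn_of_derive n _ exp); [apply is_derive_exp | exact IH].
Qed.

Lemma Cn_sin_cos n : Cn n sin /\ Cn n cos.
Proof.
induction n as [|n [Hs Hc]]; [easy|]; split.
- exact (Cn_of_derive n _ cos is_derive_sin Hc).
- apply (Cn_of_derive n _ (fun x => -1 * sin x)).
  + intro x; replace (-1 * sin x) with (- sin x) by ring; apply is_derive_cos.
  + apply Cn_mult; [apply smooth1_Cn, smooth1_const | exact Hs].
Qed.

Lemma smooth1_sin : smooth1 sin.
Proof. apply smooth1_Cn; intro n; apply Cn_sin_cos. Qed.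

Lemma smooth1_cos : smooth1 cos.
Proof. apply smooth1_Cn; intro n; apply Cn_sin_cos. Qed.

Lemma smooth1_cosh : smooth1 cosh.
Proof.
apply (smooth1_ext (fun x => / 2 * (exp x + exp (-1 * x)))).
- intro x; unfold cosh; replace (-1 * x) with (- x) by ring; field.
- apply smooth1_scal, smooth1_plus; [apply smooth1_exp|].
  apply (smooth1_comp exp); [apply smooth1_exp | apply smooth1_scal, smooth1_id].
Qed.

Lemma smooth1_sinh : smooth1 sinh.
Proof.
apply (smooth1_of_derive _ cosh); [|apply smooth1_cosh].
intro x; auto_derive; [easy | ring].
Qed.

Lemma cosh_pos x : 0 < cosh x.
Proof.
unfold cosh; generalize (exp_pos x) (exp_pos (- x)); lra.
Qed.

Lemma cosh2_sinh2 x : cosh x ^ 2 = 1 + sinh x ^ 2.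
Proof.
assert (E : exp x * exp (- x) = 1).
{ rewrite <- exp_plus; replace (x + - x) with 0 by ring; apply exp_0. }
unfold cosh, sinh; nra.
Qed.

Lemma smooth1_atan : smooth1 atan.
Proof.
apply (smooth1_of_derive _ (fun x => / (1 + x * x))).
- apply is_derive_atan.
- apply smooth1_inv; [intro x; nra|].
  apply smooth1_plus; [apply smooth1_const|].
  apply smooth1_mult; apply smooth1_id.
Qed.

Lemma smooth1_tanh : smooth1 tanh.
Proof.
apply smooth1_mult; [apply smooth1_sinh|].
apply smooth1_inv; [|apply smooth1_cosh].
intro x; apply Rgt_not_eq, cosh_pos.
Qed.

(** * Smooth functions of two variables *)

Lemma ex_diff_n_ext n : forall f g x y, (forall u v, f u v = g u v) ->
  ex_diff_n f n x y -> ex_diff_n g n x y.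
Proof.
induction n as [|n IH]; intros f g x y E; simpl.
- intros [H _]; split; [|exact I].
  now apply (continuity_2d_pt_ext f).
- intros [H0 [H1 [H2 [H3 H4]]]]; split; [now apply (continuity_2d_pt_ext f)|].
  split; [apply (ex_derive_ext (fun z => f z y)); [intro; apply E | exact H1]|].
  split; [apply (ex_derive_ext (fun z => f x z)); [intro; apply E | exact H2]|].
  split; [apply (fun e => IH _ _ _ _ e H3) | apply (fun e => IH _ _ _ _ e H4)];
    intros u v; apply Derive_ext; intro; apply E.
Qed.

(** Separated products are stable under both partial derivatives, so the induction closes. The
    coordinates of all maps on the plane considered below have this form. *)
Lemma ex_diff_n_mult f g n x y :
  smooth1 f -> smooth1 g -> ex_diff_n (fun u v => f u * g v) n x y.
Proof.
assert (C : forall f g, smooth1 f -> smooth1 g ->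
  continuity_2d_pt (fun u v => f u * g v) x y).
{ intros h k Hh Hk; apply continuity_2d_pt_mult.
  - apply (continuity_1d_2d_pt_comp h (fun u _ => u)).
    + now apply continuity_pt_filterlim, smooth1_continuous.
    + apply continuity_2d_pt_id1.
  - apply (continuity_1d_2d_pt_comp k (fun _ v => v)).
    + now apply continuity_pt_filterlim, smooth1_continuous.
    + apply continuity_2d_pt_id2. }
revert f g; induction n as [|n IH]; intros f g Hf Hg.
{ split; [now apply C | exact I]. }
assert (D1 : forall u v, is_derive (fun z => f z * g v) u (Derive f u * g v)).
{ intros u v; apply (is_derive_scal_l f u (Derive f u) (g v)).
  now apply smooth1_is_derive. }
assert (D2 : forall u v, is_derive (fun z => f u * g z) v (f u * Derive g v)).
{ intros u v; apply (is_derive_scal g v (f u) (Derive g v)).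
  now apply smooth1_is_derive. }
split; [now apply C|]; split; [eexists; apply D1|]; split; [eexists; apply D2|].
split.
- apply (ex_diff_n_ext n (fun u v => Derive f u * g v)).
  + intros u v; symmetry; now apply is_derive_unique.
  + apply IH; [now apply smooth1_Derive | exact Hg].
- apply (ex_diff_n_ext n (fun u v => f u * Derive g v)).
  + intros u v; symmetry; now apply is_derive_unique.
  + apply IH; [exact Hf | now apply smooth1_Derive].
Qed.

Lemma smooth_mult f g :
  smooth1 f -> smooth1 g -> smooth (fun p => f (fst p) * g (snd p)).
Proof. intros Hf Hg n x y; now apply (ex_diff_n_mult f g). Qed.

Lemma smooth1_dilate c f : smooth1 f -> smooth1 (fun u => f (c * u)).
Proof.
intro Hf; apply (smooth1_comp f (fun u => c * u)); [exact Hf|].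
apply smooth1_scal, smooth1_id.
Qed.

Lemma smooth_fst_comp g : smooth1 g -> smooth (fun z => g (fst z)).
Proof.
intros Hg n t s.
apply (ex_diff_n_ext n (fun t s => g t * 1)); [intros; apply Rmult_1_r|].
apply (ex_diff_n_mult g (fun _ => 1)); [exact Hg | apply smooth1_const].
Qed.

Lemma smooth_snd_comp g : smooth1 g -> smooth (fun z => g (snd z)).
Proof.
intros Hg n t s.
apply (ex_diff_n_ext n (fun t s => 1 * g s)); [intros; apply Rmult_1_l|].
apply (ex_diff_n_mult (fun _ => 1) g); [apply smooth1_const | exact Hg].
Qed.

(** * Partial derivatives of maps into space *)

Lemma is_derive_mulr (f : R -> R) (x l c : R) :
  is_derive f x l -> is_derive (fun t => f t * c) x (l * c).
Proof. exact (is_derive_scal_l f x l c). Qed.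

Lemma D1_is_derive f u v a b c :
  is_derive (fun t => px (f (t, v))) u a ->
  is_derive (fun t => py (f (t, v))) u b ->
  is_derive (fun t => pz (f (t, v))) u c ->
  D1 f (u, v) = (a, b, c).
Proof.
intros Ha Hb Hc; unfold D1, d1; simpl.
now f_equal; [f_equal|]; apply is_derive_unique.
Qed.

Lemma D2_is_derive f u v a b c :
  is_derive (fun t => px (f (u, t))) v a ->
  is_derive (fun t => py (f (u, t))) v b ->
  is_derive (fun t => pz (f (u, t))) v c ->
  D2 f (u, v) = (a, b, c).
Proof.
intros Ha Hb Hc; unfold D2, d2; simpl.
now f_equal; [f_equal|]; apply is_derive_unique.
Qed.

Lemma D1_ext f g p : (forall q, f q = g q) -> D1 f p = D1 g p.
Proof.
intro E; unfold D1, d1; f_equal; [f_equal|]; apply Derive_ext; intro t;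
  now rewrite E.
Qed.

Lemma D2_ext f g p : (forall q, f q = g q) -> D2 f p = D2 g p.
Proof.
intro E; unfold D2, d2; f_equal; [f_equal|]; apply Derive_ext; intro t;
  now rewrite E.
Qed.

Lemma triple_eq (a b c a' b' c' : R) :
  a = a' -> b = b' -> c = c' -> (a, b, c) = (a', b', c').
Proof. now intros -> -> ->. Qed.

Lemma cos2_sin2 t : cos t * cos t = 1 - sin t * sin t.
Proof. generalize (sin2_cos2 t); unfold Rsqr; lra. Qed.

(** * Tori with hyperbolic arclength profile *)

(* The profile is [(x, exp q)] with Euclidean tangent angle [Phi], so that [s] is
   the hyperbolic arclength. *)
Section ArclengthProfile.

Variables (b : R) (x q Phi k : R -> R).
Hypothesis b_gt0 : 0 < b.
Hypothesis (x_smooth : smooth1 x) (q_smooth : smooth1 q).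
Hypothesis Phi_smooth : smooth1 Phi.
Hypothesis x_derive : forall s, is_derive x s (exp (q s) * cos (Phi s)).
Hypothesis q_derive : forall s, is_derive q s (sin (Phi s)).
Hypothesis Phi_derive : forall s, is_derive Phi s (k s).
Hypothesis x_periodic : forall s, x (s + 2 * PI * b) = x s.
Hypothesis q_periodic : forall s, q (s + 2 * PI * b) = q s.

Let L := 2 * PI * b.

Definition profile (u : R) : R * R := (x (L * u), exp (q (L * u))).

Definition torus : R * R -> R3 := revolve profile.

Lemma L_gt0 : 0 < L.
Proof. generalize PI_RGT_0; unfold L; intro; nra. Qed.

Lemma smooth1_exp_q : smooth1 (fun s => exp (q s)).
Proof. apply (smooth1_comp exp); [apply smooth1_exp | exact q_smooth]. Qed.

Lemma derive_x u :
  is_derive (fun t => x (L * t)) u (L * (exp (q (L * u)) * cos (Phi (L * u)))).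
Proof.
evar_last; [apply (is_derive_comp x (fun t => L * t)); [apply x_derive|]|].
- auto_derive; [easy | reflexivity].
- unfold scal; simpl; unfold mult; simpl; ring.
Qed.

Lemma derive_y u :
  is_derive (fun t => exp (q (L * t))) u
    (L * (exp (q (L * u)) * sin (Phi (L * u)))).
Proof.
evar_last.
- apply (is_derive_comp exp (fun t => q (L * t))); [apply is_derive_exp|].
  apply (is_derive_comp q (fun t => L * t)); [apply q_derive|].
  auto_derive; [easy | reflexivity].
- unfold scal; simpl; unfold mult; simpl; ring.
Qed.

Lemma derive_Phi u :
  is_derive (fun t => Phi (L * t)) u (L * k (L * u)).
Proof.
evar_last; [apply (is_derive_comp Phi (fun t => L * t)); [apply Phi_derive|]|].
- auto_derive; [easy | reflexivity].
- unfold scal; simpl; unfold mult; simpl; ring.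
Qed.

Definition torus_u (p : R * R) : R3 :=
  let s := L * fst p in
  (L * (exp (q s) * cos (Phi s)),
   L * (exp (q s) * sin (Phi s)) * cos (2 * PI * snd p),
   L * (exp (q s) * sin (Phi s)) * sin (2 * PI * snd p)).

Definition torus_v (p : R * R) : R3 :=
  (0, exp (q (L * fst p)) * - (2 * PI * sin (2 * PI * snd p)),
   exp (q (L * fst p)) * (2 * PI * cos (2 * PI * snd p))).

Lemma D1_torus p : D1 torus p = torus_u p.
Proof.
destruct p as [u v]; apply D1_is_derive; unfold px, py, pz; simpl.
- apply derive_x.
- apply is_derive_mulr, derive_y.
- apply is_derive_mulr, derive_y.
Qed.

Lemma D2_torus p : D2 torus p = torus_v p.
Proof.
destruct p as [u v]; apply D2_is_derive; unfold px, py, pz; simpl;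
  auto_derive; try easy; ring.
Qed.

Definition torus_uu (p : R * R) : R3 :=
  let s := L * fst p in
  let E := L * L * exp (q s) in
  let S := sin (Phi s) in let C := cos (Phi s) in
  (E * (S * C - S * k s),
   E * (S * S + C * k s) * cos (2 * PI * snd p),
   E * (S * S + C * k s) * sin (2 * PI * snd p)).

Definition torus_vv (p : R * R) : R3 :=
  let E := 4 * PI ^ 2 * exp (q (L * fst p)) in
  (0, - (E * cos (2 * PI * snd p)), - (E * sin (2 * PI * snd p))).

Lemma derive_yC u :
  is_derive (fun t => L * (exp (q (L * t)) * cos (Phi (L * t)))) u
   (L * L * exp (q (L * u)) *
    (sin (Phi (L * u)) * cos (Phi (L * u)) - sin (Phi (L * u)) * k (L * u))).
Proof.
evar_last.
- apply is_derive_scal.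
  apply (is_derive_mult (fun t => exp (q (L * t))) (fun t => cos (Phi (L * t)))).
  + apply derive_y.
  + apply (is_derive_comp cos (fun t => Phi (L * t))); [apply is_derive_cos|].
    apply derive_Phi.
  + intros; apply Rmult_comm.
- unfold scal, plus; simpl; unfold mult; simpl; ring.
Qed.

Lemma derive_yS u :
  is_derive (fun t => L * (exp (q (L * t)) * sin (Phi (L * t)))) u
   (L * L * exp (q (L * u)) *
    (sin (Phi (L * u)) * sin (Phi (L * u)) + cos (Phi (L * u)) * k (L * u))).
Proof.
evar_last.
- apply is_derive_scal.
  apply (is_derive_mult (fun t => exp (q (L * t))) (fun t => sin (Phi (L * t)))).
  + apply derive_y.
  + apply (is_derive_comp sin (fun t => Phi (L * t))); [apply is_derive_sin|].
    apply derive_Phi.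
  + intros; apply Rmult_comm.
- unfold scal, plus; simpl; unfold mult; simpl; ring.
Qed.

Lemma D1_D1_torus p : D1 (D1 torus) p = torus_uu p.
Proof.
rewrite (D1_ext _ _ _ D1_torus).
destruct p as [u v]; apply D1_is_derive; unfold px, py, pz; simpl.
- apply derive_yC.
- apply is_derive_mulr, derive_yS.
- apply is_derive_mulr, derive_yS.
Qed.

Lemma D2_D2_torus p : D2 (D2 torus) p = torus_vv p.
Proof.
rewrite (D2_ext _ _ _ D2_torus).
destruct p as [u v]; apply D2_is_derive; unfold px, py, pz; simpl;
  auto_derive; try easy; ring.
Qed.

Definition normal (p : R * R) : R3 :=
  (sin (Phi (L * fst p)),
   - (cos (Phi (L * fst p)) * cos (2 * PI * snd p)),
   - (cos (Phi (L * fst p)) * sin (2 * PI * snd p))).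

Lemma cross_torus p :
  cross (D1 torus p) (D2 torus p) =
  scal3 (2 * PI * L * exp (q (L * fst p)) ^ 2) (normal p).
Proof.
rewrite D1_torus, D2_torus; unfold cross, scal3, torus_u, torus_v, normal, px, py, pz.
simpl; apply triple_eq; try ring.
generalize (cos2_sin2 (2 * PI * snd p)); intro E.
match goal with |- ?l = ?r => transitivity
  (2 * PI * L * exp (q (L * fst p)) ^ 2 * sin (Phi (L * fst p)) *
   (cos (2 * PI * snd p) * cos (2 * PI * snd p) +
    sin (2 * PI * snd p) * sin (2 * PI * snd p))) end; [ring|].
rewrite E; ring.
Qed.

Lemma dot_normal p : dot (normal p) (normal p) = 1.
Proof.
unfold dot, normal, px, py, pz; simpl.
set (t := Phi (L * fst p)); set (w := 2 * PI * snd p).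
transitivity (sin t * sin t + cos t * cos t * (cos w * cos w + sin w * sin w));
  [ring|].
rewrite 2!cos2_sin2; ring.
Qed.

Lemma area_gt0 (p : R * R) : 0 < 2 * PI * L * exp (q (L * fst p)) ^ 2.
Proof.
generalize L_gt0 PI_RGT_0 (exp_pos (q (L * fst p))); intros H1 H2 H3.
apply Rmult_lt_0_compat; [nra | now apply pow_lt].
Qed.

Lemma norm3_scal c a : dot a a = 1 -> 0 <= c -> norm3 (scal3 c a) = c.
Proof.
intros H Hc; unfold norm3.
replace (dot (scal3 c a) (scal3 c a)) with (c * c * dot a a).
- rewrite H, Rmult_1_r; now apply sqrt_square.
- unfold dot, scal3, px, py, pz; simpl; ring.
Qed.

Lemma unit_normal_torus p : unit_normal torus p = normal p.
Proof.
unfold unit_normal; rewrite cross_torus.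
rewrite norm3_scal; [|apply dot_normal | apply Rlt_le, area_gt0].
generalize (area_gt0 p); set (c := _ * exp _ ^ 2); intro Hc.
unfold scal3, normal, px, py, pz; simpl; apply triple_eq; field; lra.
Qed.

Lemma g11_torus p : g11 torus p = L ^ 2 * exp (q (L * fst p)) ^ 2.
Proof.
unfold g11; rewrite D1_torus; unfold dot, torus_u, px, py, pz; simpl.
set (t := Phi (L * fst p)); set (w := 2 * PI * snd p); set (E := exp _).
transitivity (L * L * (E * E) * (cos t * cos t +
  sin t * sin t * (cos w * cos w + sin w * sin w))); [ring|].
rewrite 2!cos2_sin2; ring.
Qed.

Lemma g12_torus p : g12 torus p = 0.
Proof.
unfold g12; rewrite D1_torus, D2_torus.
unfold dot, torus_u, torus_v, px, py, pz; simpl; ring.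
Qed.

Lemma g22_torus p : g22 torus p = 4 * PI ^ 2 * exp (q (L * fst p)) ^ 2.
Proof.
unfold g22; rewrite D2_torus; unfold dot, torus_v, px, py, pz; simpl.
set (w := 2 * PI * snd p); set (E := exp _).
transitivity (4 * (PI * PI) * (E * E) * (cos w * cos w + sin w * sin w)); [ring|].
rewrite cos2_sin2; ring.
Qed.

Lemma h11_torus p :
  h11 torus p = - L ^ 2 * exp (q (L * fst p)) * k (L * fst p).
Proof.
unfold h11; rewrite D1_D1_torus, unit_normal_torus.
unfold dot, torus_uu, normal, px, py, pz; simpl.
set (t := Phi (L * fst p)); set (w := 2 * PI * snd p); set (E := exp _).
set (K := k _).
transitivity (L * L * E * ((sin t * cos t - sin t * K) * sin t -
  (sin t * sin t + cos t * K) * cos t * (cos w * cos w + sin w * sin w))); [ring|].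
rewrite (cos2_sin2 w).
transitivity (- (L * L * E * K) * (sin t * sin t + cos t * cos t)); [ring|].
rewrite cos2_sin2; ring.
Qed.

Lemma h22_torus p :
  h22 torus p = 4 * PI ^ 2 * exp (q (L * fst p)) * cos (Phi (L * fst p)).
Proof.
unfold h22; rewrite D2_D2_torus, unit_normal_torus.
unfold dot, torus_vv, normal, px, py, pz; simpl.
set (t := Phi (L * fst p)); set (w := 2 * PI * snd p); set (E := exp _).
transitivity (4 * (PI * PI) * E * cos t * (cos w * cos w + sin w * sin w)); [ring|].
rewrite (cos2_sin2 w); ring.
Qed.

(** With [y = exp q], the principal curvatures are [- k / y] along the profile and [cos Phi / y]
    along the parallels. *)
Lemma mean_curvature_torus p :
  mean_curvature torus p =
  (cos (Phi (L * fst p)) - k (L * fst p)) / exp (q (L * fst p)).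
Proof.
unfold mean_curvature, detg.
rewrite g11_torus, g12_torus, g22_torus, h11_torus, h22_torus.
generalize L_gt0 PI_RGT_0 (exp_pos (q (L * fst p))); intros H1 H2 H3.
field; repeat split; apply Rgt_not_eq; assumption.
Qed.

(** The factor [y ^ 2] in the area density cancels the [y ^ -2] of the squared mean curvature; the
    energy thus sees only the angle as a function of hyperbolic arclength. *)
Lemma willmore_density_torus u v :
  Rsqr (norm3 (mean_curvature_vector torus (u, v))) * sqrt (detg torus (u, v)) =
  2 * PI * (L * (k (L * u) - cos (Phi (L * u))) ^ 2).
Proof.
replace (detg torus (u, v)) with (Rsqr (2 * PI * L * exp (q (L * u)) ^ 2)).
2:{ unfold detg; rewrite g11_torus, g12_torus, g22_torus; unfold Rsqr; simpl; ring. }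
rewrite sqrt_Rsqr; [|apply Rlt_le, (area_gt0 (u, v))].
unfold norm3; rewrite Rsqr_sqrt.
2:{ unfold dot; nra. }
unfold mean_curvature_vector; rewrite unit_normal_torus.
set (H := mean_curvature torus (u, v)).
replace (dot _ _) with (H ^ 2 * dot (normal (u, v)) (normal (u, v))).
2:{ unfold dot, scal3, px, py, pz; simpl; ring. }
rewrite dot_normal; unfold H; rewrite mean_curvature_torus; simpl fst.
generalize (exp_pos (q (L * u))); intro; field; lra.
Qed.

Lemma smooth1_k : smooth1 k.
Proof.
apply (smooth1_ext (Derive Phi)); [|now apply smooth1_Derive].
intro s; apply is_derive_unique, Phi_derive.
Qed.

Lemma willmore_torus :
  willmore_energy torus =
  PI / 2 * RInt (fun s => (k s - cos (Phi s)) ^ 2) 0 (2 * PI * b).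
Proof.
unfold willmore_energy.
rewrite (RInt_ext _ (fun u => 2 * PI * (L * (k (L * u) - cos (Phi (L * u))) ^ 2))).
2:{ intros u _.
    rewrite (RInt_ext _ (fun _ => 2 * PI * (L * (k (L * u) - cos (Phi (L * u))) ^ 2))).
    - rewrite RInt_const; unfold scal; simpl; unfold mult; simpl; ring.
    - intros v _; apply willmore_density_torus. }
assert (Sm : smooth1 (fun s => (k s - cos (Phi s)) ^ 2)).
{ apply (smooth1_ext (fun s => (k s - cos (Phi s)) * (k s - cos (Phi s))));
    [intro t; match goal with |- ?l = ?r => change (l = r :> R) end; ring|].
  assert (smooth1 (fun s => k s - cos (Phi s))).
  { apply smooth1_minus; [apply smooth1_k|].
    apply (smooth1_comp cos); [apply smooth1_cos | exact Phi_smooth]. }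
  now apply smooth1_mult. }
assert (Ex : forall c d, ex_RInt (fun s => (k s - cos (Phi s)) ^ 2) c d).
{ intros c d; apply (ex_RInt_continuous (V := R_CompleteNormedModule)).
  intros z _; now apply (smooth1_continuous (fun s => (k s - cos (Phi s)) ^ 2)). }
(* Substitution [s = L * u], as an affine change of variables with offset 0. *)
generalize (RInt_comp_lin (V := R_CompleteNormedModule)
  (fun s => (k s - cos (Phi s)) ^ 2) L 0 0 1).
replace (L * 0 + 0) with 0 by ring; replace (L * 1 + 0) with (2 * PI * b) by (unfold L; ring).
intro E; specialize (E (Ex _ _)).
rewrite <- E, (RInt_ext _ (fun u => scal (2 * PI)
   (scal L ((k (L * u + 0) - cos (Phi (L * u + 0))) ^ 2)))).
2:{ intros u _; rewrite Rplus_0_r; reflexivity. }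
rewrite (RInt_scal (V := R_CompleteNormedModule)).
- unfold scal; simpl; unfold mult; simpl; field.
- apply (ex_RInt_comp_lin (V := R_NormedModule) (fun s => (k s - cos (Phi s)) ^ 2)).
  replace (L * 0 + 0) with 0 by ring; apply Ex.
Qed.

Lemma torus_smooth : smooth_map3 torus.
Proof.
split; [|split]; unfold px, py, pz; simpl.
- intros n u v.
  apply (ex_diff_n_ext n (fun u v => x (L * u) * 1)).
  { intros; apply Rmult_1_r. }
  apply (ex_diff_n_mult (fun u => x (L * u)) (fun _ => 1));
    [now apply smooth1_dilate | apply smooth1_const].
- apply (smooth_mult (fun u => exp (q (L * u))) (fun v => cos (2 * PI * v))).
  + apply (smooth1_dilate L (fun s => exp (q s))), smooth1_exp_q.
  + apply smooth1_dilate, smooth1_cos.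
- apply (smooth_mult (fun u => exp (q (L * u))) (fun v => sin (2 * PI * v))).
  + apply (smooth1_dilate L (fun s => exp (q s))), smooth1_exp_q.
  + apply smooth1_dilate, smooth1_sin.
Qed.

Lemma profile_periodic u : profile (u + 1) = profile u.
Proof.
unfold profile; replace (L * (u + 1)) with (L * u + 2 * PI * b) by (unfold L; ring).
now rewrite x_periodic, q_periodic.
Qed.

Lemma torus_of_revolution_torus : torus_of_revolution torus.
Proof.
split; [split; [exact torus_smooth|]; split; [|split]|].
- intros u v; unfold torus, revolve.
  change (fst (u + 1, v)) with (u + 1); now rewrite profile_periodic.
- intros u v; unfold torus, revolve.
  change (snd (u, v + 1)) with (v + 1); change (snd (u, v)) with v.
  replace (2 * PI * (v + 1)) with (2 * PI * v + 2 * PI) by ring.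
  rewrite cos_plus, sin_plus, cos_2PI, sin_2PI.
  apply triple_eq; simpl; ring.
(* The norm of the cross product is the positive area density, so the product cannot vanish. *)
- intro p; rewrite cross_torus; intro E.
  generalize (norm3_scal _ _ (dot_normal p) (Rlt_le _ _ (area_gt0 p))) (area_gt0 p).
  rewrite E; unfold norm3, dot, px, py, pz; simpl.
  replace (0 * 0 + 0 * 0 + 0 * 0) with 0 by ring; rewrite sqrt_0.
  generalize (area_gt0 p); lra.
- exists profile; split; [|reflexivity].
  split; [now apply smooth1_dilate|]; split.
  { apply (smooth1_dilate L (fun s => exp (q s))), smooth1_exp_q. }
  split; [exact profile_periodic|]; split; [intro; apply exp_pos|].
  (* A vanishing tangent would make [sin Phi] and [cos Phi] vanish together. *)
  intros u E; injection E; unfold profile; simpl; intros E2 E1.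
  generalize L_gt0 (exp_pos (q (L * u))); intros H1 H2.
  assert (H3 : 0 < L * exp (q (L * u))) by now apply Rmult_lt_0_compat.
  generalize (eq_trans (eq_sym E1) (is_derive_unique _ _ _ (derive_x u)))
    (eq_trans (eq_sym E2) (is_derive_unique _ _ _ (derive_y u))).
  clear E E1 E2; intros E1 E2.
  assert (S0 : sin (Phi (L * u)) = 0) by nra.
  assert (C0 : cos (Phi (L * u)) = 0) by nra.
  generalize (sin2_cos2 (Phi (L * u))); rewrite S0, C0; unfold Rsqr; lra.
Qed.

(** * Conformal parametrization *)

(** The coordinates are swapped: the real direction, of period 1, runs along the parallels and the
    imaginary one, of period [b], along the profile. Both have speed [2 * PI * y], and the lattice
    is the one of [i b] rather than [i / b]. *)
Definition conformal_torus (z : C) : R3 := torus (/ b * snd z, fst z).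

Lemma L_div_b t : L * (/ b * t) = 2 * PI * t.
Proof. unfold L; field; lra. Qed.

Lemma D1_conformal z :
  D1 conformal_torus z =
  (0, exp (q (2 * PI * snd z)) * - (2 * PI * sin (2 * PI * fst z)),
   exp (q (2 * PI * snd z)) * (2 * PI * cos (2 * PI * fst z))).
Proof.
destruct z as [t s]; apply D1_is_derive; unfold px, py, pz; simpl;
  rewrite L_div_b; auto_derive; try easy; ring.
Qed.

Lemma D2_conformal z :
  D2 conformal_torus z =
  let s := 2 * PI * snd z in
  (2 * PI * (exp (q s) * cos (Phi s)),
   2 * PI * (exp (q s) * sin (Phi s)) * cos (2 * PI * fst z),
   2 * PI * (exp (q s) * sin (Phi s)) * sin (2 * PI * fst z)).
Proof.
assert (DD : forall t, is_derive (fun t => / b * t) t (/ b)).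
{ intro t; auto_derive; [easy | ring]. }
destruct z as [t s]; apply D2_is_derive; unfold px, py, pz; simpl.
- evar_last; [apply (is_derive_comp (fun u => x (L * u)) (fun t => / b * t))|].
  + apply derive_x.
  + apply DD.
  + rewrite L_div_b; unfold scal; simpl; unfold mult; simpl; unfold L; field; lra.
- apply (is_derive_mulr (fun s => exp (q (L * (/ b * s))))).
  evar_last; [apply (is_derive_comp (fun u => exp (q (L * u))) (fun t => / b * t))|].
  + apply derive_y.
  + apply DD.
  + rewrite L_div_b; unfold scal; simpl; unfold mult; simpl; unfold L; field; lra.
- apply (is_derive_mulr (fun s => exp (q (L * (/ b * s))))).
  evar_last; [apply (is_derive_comp (fun u => exp (q (L * u))) (fun t => / b * t))|].
  + apply derive_y.
  + apply DD.
  + rewrite L_div_b; unfold scal; simpl; unfold mult; simpl; unfold L; field; lra.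
Qed.

Lemma conformal_torus_smooth : smooth_map3 conformal_torus.
Proof.
assert (Sy : smooth1 (fun s => exp (q (L * (/ b * s))))).
{ apply (smooth1_dilate (/ b) (fun u => exp (q (L * u)))).
  apply (smooth1_dilate L (fun s => exp (q s))), smooth1_exp_q. }
split; [|split]; unfold px, py, pz; simpl.
- apply (smooth_snd_comp (fun s => x (L * (/ b * s)))).
  now apply (smooth1_dilate (/ b) (fun u => x (L * u))), smooth1_dilate.
- intros n t s; apply (ex_diff_n_ext n
    (fun t s => cos (2 * PI * t) * exp (q (L * (/ b * s)))));
    [intros; apply Rmult_comm|].
  apply (ex_diff_n_mult (fun t => cos (2 * PI * t)) (fun s => exp (q (L * (/ b * s)))));
    [apply smooth1_dilate, smooth1_cos | exact Sy].
- intros n t s; apply (ex_diff_n_ext n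
    (fun t s => sin (2 * PI * t) * exp (q (L * (/ b * s)))));
    [intros; apply Rmult_comm|].
  apply (ex_diff_n_mult (fun t => sin (2 * PI * t)) (fun s => exp (q (L * (/ b * s)))));
    [apply smooth1_dilate, smooth1_sin | exact Sy].
Qed.

Lemma torus_diffeo_swap :
  torus_diffeo (0, b) (fun z => (/ b * snd z, fst z)).
Proof.
split; [split|split].
- apply (smooth_snd_comp (fun s => / b * s)), smooth1_scal, smooth1_id.
- apply (smooth_fst_comp (fun s => s)), smooth1_id.
- intros z w [m [n ->]]; exists n, m; simpl; f_equal; field; lra.
- exists (fun p => (snd p, b * fst p)); split; [split|split; [|split]].
  + apply (smooth_snd_comp (fun s => s)), smooth1_id.
  + apply (smooth_fst_comp (fun s => b * s)), smooth1_scal, smooth1_id.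
  + intros p r [m [n ->]]; exists n, m.
    unfold Cplus, Cmult; simpl; f_equal; ring.
  + intros [t s]; exists 0%Z, 0%Z.
    unfold Cplus, Cmult; simpl; f_equal; field; lra.
  + intros [t s]; exists 0%Z, 0%Z; simpl; f_equal; field; lra.
Qed.

Lemma conformal_class_torus :
  1 <= b -> is_conformal_class torus (Ci * RtoC b)%C.
Proof.
intro hb.
replace (Ci * RtoC b)%C with (0, b) by (unfold Cmult; simpl; f_equal; ring).
split; [|split; [simpl; lra|split; [simpl; lra|]]].
{ apply Rle_trans with (1 := hb), Rle_trans with (1 := Rle_abs b).
  exact (Rle_trans _ _ _ (Rmax_r _ _) (Rmax_Cmod (0, b))). }
exists conformal_torus; split; [apply conformal_torus_smooth|]; split.
{ exists (fun z => (/ b * snd z, fst z)); split; [apply torus_diffeo_swap|].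
  reflexivity. }
(* The logarithm of the common speed [2 * PI * exp q]. *)
exists (fun z => ln (2 * PI) + q (2 * PI * snd z)); split; [|split].
- apply (smooth_snd_comp (fun s => ln (2 * PI) + q (2 * PI * s))).
  apply smooth1_plus; [apply smooth1_const | now apply smooth1_dilate].
- assert (P : forall n s, q (s + INR n * L) = q s).
  { induction n as [|n IH]; intro s; [simpl; f_equal; ring|].
    rewrite S_INR; replace (s + (INR n + 1) * L) with (s + INR n * L + 2 * PI * b)
      by (unfold L; ring).
    now rewrite q_periodic. }
  intros z w [m [n ->]]; simpl; f_equal.
  replace (2 * PI * (snd z + (0 + (IZR n * b + 0 * 0)))) with
    (2 * PI * snd z + IZR n * L) by (unfold L; ring).
  destruct (Z_le_gt_dec 0 n) as [Hn|Hn].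
  + rewrite <- (Z2Nat.id n Hn), <- INR_IZR_INZ; now rewrite P.
  (* For negative [n], shift back by [- n] periods. *)
  + rewrite <- (P (Z.to_nat (- n)) (2 * PI * snd z + IZR n * L)).
    rewrite INR_IZR_INZ, Z2Nat.id, opp_IZR by lia; f_equal; ring.
- intro z; unfold g11, g22, g12.
  rewrite D1_conformal, D2_conformal; unfold dot, px, py, pz; simpl.
  set (t := Phi _); set (w := 2 * PI * fst z); set (Q := q _).
  replace (2 * (ln (2 * PI) + Q)) with (ln (2 * PI) + ln (2 * PI) + (Q + Q)) by ring.
  rewrite 3!exp_plus, exp_ln by (generalize PI_RGT_0; lra).
  split; [|split].
  + transitivity (2 * PI * (2 * PI) * (exp Q * exp Q) *
      (cos w * cos w + sin w * sin w)); [ring|].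
    rewrite cos2_sin2; ring.
  + transitivity (2 * PI * (2 * PI) * (exp Q * exp Q) *
      (cos t * cos t + sin t * sin t * (cos w * cos w + sin w * sin w))); [ring|].
    rewrite 2!cos2_sin2; ring.
  + ring.
Qed.

End ArclengthProfile.

(** * Closing the profile by reflections *)

Lemma is_derive_zero_const (f : R -> R) :
  (forall s, is_derive f s 0) -> forall s t, f s = f t.
Proof.
intros D; assert (H : forall s t, s < t -> f s = f t).
{ intros s t st; apply eq_is_derive; [intros; apply D | exact st]. }
intros s t; destruct (Rtotal_order s t) as [st|[->|st]]; auto.
symmetry; auto.
Qed.

Lemma is_derive_reflect (G g : R -> R) (a s : R) :
  (forall s, is_derive G s (g s)) ->
  is_derive (fun s => G (2 * a - s)) s (- g (2 * a - s)).
Proof.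
intro D; evar_last.
- apply (is_derive_comp G (fun s => 2 * a - s)); [apply D|].
  auto_derive; [easy | reflexivity].
- unfold scal; simpl; unfold mult; simpl; ring.
Qed.

(** [G (2 * a - s) + G s] has derivative zero and value [2 * G a] at [a]. This and its odd
    counterpart carry the symmetries of a rotation rate over to the curve. *)
Lemma antiderivative_of_even (G g : R -> R) (a : R) :
  (forall s, is_derive G s (g s)) -> (forall s, g (2 * a - s) = g s) ->
  forall s, G (2 * a - s) = 2 * G a - G s.
Proof.
intros D E s.
assert (H := is_derive_zero_const (fun s => G (2 * a - s) + G s)).
assert (Z : forall t, is_derive (fun s => G (2 * a - s) + G s) t 0).
{ intro t; replace 0 with (- g (2 * a - t) + g t) by (rewrite E; ring).
  apply (is_derive_plus (fun s => G (2 * a - s)) G); [|apply D].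
  now apply is_derive_reflect. }
specialize (H Z s a); simpl in H.
replace (2 * a - a) with a in H by ring; lra.
Qed.

Lemma antiderivative_of_odd (G g : R -> R) (a : R) :
  (forall s, is_derive G s (g s)) -> (forall s, g (2 * a - s) = - g s) ->
  forall s, G (2 * a - s) = G s.
Proof.
intros D E s.
assert (H := is_derive_zero_const (fun s => G (2 * a - s) - G s)).
assert (Z : forall t, is_derive (fun s => G (2 * a - s) - G s) t 0).
{ intro t; replace 0 with (- g (2 * a - t) - g t) by (rewrite E; ring).
  apply (is_derive_minus (fun s => G (2 * a - s)) G); [|apply D].
  now apply is_derive_reflect. }
specialize (H Z s a); simpl in H.
replace (2 * a - a) with a in H by ring; lra.
Qed.

Lemma smooth1_antiderivative (g : R -> R) (a v : R) :
  smooth1 g ->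
  exists G, (forall s, is_derive G s (g s)) /\ smooth1 G /\ G a = v.
Proof.
intro Hg; exists (fun s => v + RInt g a s).
assert (D : forall s, is_derive (fun s => v + RInt g a s) s (g s)).
{ intro s; evar_last.
  - apply (is_derive_plus (fun _ => v) (fun s => RInt g a s)).
    + apply (is_derive_const v).
    + apply (is_derive_RInt g (fun s => RInt g a s) a).
      * apply filter_forall; intro t.
        apply (RInt_correct (V := R_CompleteNormedModule)).
        apply (ex_RInt_continuous (V := R_CompleteNormedModule)).
        intros; now apply smooth1_continuous.
      * now apply smooth1_continuous.
  - unfold plus, zero; simpl; ring. }
split; [exact D|]; split; [now apply (smooth1_of_derive _ g)|].
rewrite RInt_point; unfold zero; simpl; ring.
Qed.

Lemma sqrt_1_sinh2 t : sqrt (1 + (sinh t)²) = cosh t.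
Proof.
replace (1 + (sinh t)²) with (cosh t * cosh t).
- apply sqrt_square, Rlt_le, cosh_pos.
- generalize (cosh2_sinh2 t); unfold Rsqr; lra.
Qed.

(** [atan (sinh t)] is the Gudermannian of [t]: at signed distance [t] from the geodesic [x = 0],
    the direction of increasing distance has Euclidean angle [- atan (sinh t)]. *)
Lemma cos_gd t : cos (atan (sinh t)) = / cosh t.
Proof. rewrite cos_atan, sqrt_1_sinh2; unfold Rdiv; ring. Qed.

Lemma sin_gd t : sin (atan (sinh t)) = tanh t.
Proof. now rewrite sin_atan, sqrt_1_sinh2. Qed.

Lemma tanh_opp t : tanh (- t) = - tanh t.
Proof.
unfold tanh, sinh, cosh; rewrite Ropp_involutive.
generalize (exp_pos t) (exp_pos (- t)); intros; field; lra.
Qed.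

Lemma cosh_opp t : cosh (- t) = cosh t.
Proof. unfold cosh; rewrite Ropp_involutive; lra. Qed.

(* [c] is the rotation rate, with respect to arclength, of the angle [chi]
   between the curve and the direction in which the Fermi coordinate [rho] (the
   signed distance to the geodesic [x = 0]) increases. *)
Lemma torus_of_rotation_rate (b : R) (c chi rho : R -> R) :
  0 < b -> smooth1 c ->
  (forall s, c (- s) = c s) -> (forall s, c (PI * b - s) = c s) ->
  (forall s, is_derive chi s (c s)) -> chi 0 = 0 -> chi (PI * b / 2) = PI / 2 ->
  (forall s, is_derive rho s (cos (chi s))) -> rho 0 = 0 ->
  exists x q Phi k : R -> R,
    smooth1 x /\ smooth1 q /\ smooth1 Phi /\
    (forall s, is_derive x s (exp (q s) * cos (Phi s))) /\
    (forall s, is_derive q s (sin (Phi s))) /\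
    (forall s, is_derive Phi s (k s)) /\
    (forall s, x (s + 2 * PI * b) = x s) /\
    (forall s, q (s + 2 * PI * b) = q s) /\
    RInt (fun s => (k s - cos (Phi s)) ^ 2) 0 (2 * PI * b) =
    4 * RInt (fun s => (c s + sin (chi s) * tanh (rho s)) ^ 2) 0 (PI * b / 2).
Proof.
intros b_gt0 c_smooth c_even c_refl chi_derive chi_0 chi_l rho_derive rho_0.
set (l := PI * b / 2) in *.
replace (2 * PI * b) with (4 * l) by (unfold l; field).
replace (PI * b) with (2 * l) in c_refl by (unfold l; field).
assert (chi_smooth : smooth1 chi) by now apply (smooth1_of_derive _ c).
assert (rho_smooth : smooth1 rho).
{ apply (smooth1_of_derive _ _ rho_derive).
  now apply (smooth1_comp cos); [apply smooth1_cos|]. }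
assert (even0 : forall g : R -> R, (forall s, g (- s) = g s) ->
  forall s, g (2 * 0 - s) = g s).
{ intros g E s; rewrite <- E; f_equal; ring. }
(* The symmetries of [c] about 0 and about [l] pass to [chi], then to [rho], then to [p], each being
   an antiderivative built from the preceding ones. *)
assert (chi_opp : forall s, chi (- s) = - chi s).
{ intro s; generalize (antiderivative_of_even chi c 0 chi_derive (even0 c c_even) s).
  rewrite chi_0; replace (2 * 0 - s) with (- s) by ring; lra. }
assert (chi_refl : forall s, chi (2 * l - s) = PI - chi s).
{ intro s; rewrite (antiderivative_of_even chi c l chi_derive c_refl s), chi_l; field. }
assert (rho_opp : forall s, rho (- s) = - rho s).
{ intro s; generalize (antiderivative_of_even rho _ 0 rho_derive
    (even0 _ (fun s => eq_trans (f_equal cos (chi_opp s)) (cos_neg (chi s)))) s).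
  rewrite rho_0; replace (2 * 0 - s) with (- s) by ring; lra. }
assert (rho_refl : forall s, rho (2 * l - s) = rho s).
{ apply (antiderivative_of_odd _ _ l rho_derive); intro s.
  rewrite chi_refl; apply Rtrigo_facts.cos_pi_minus. }
assert (sin_opp : forall s, sin (chi (- s)) = - sin (chi s)).
{ intro s; now rewrite chi_opp, sin_neg. }
assert (sin_refl : forall s, sin (chi (2 * l - s)) = sin (chi s)).
{ intro s; rewrite chi_refl; apply Rtrigo_facts.sin_pi_minus. }
assert (coshN : forall t, cosh t <> 0) by (intro t; apply Rgt_not_eq, cosh_pos).
assert (sech_smooth : smooth1 (fun s => / cosh (rho s))).
{ apply (smooth1_inv (fun s => cosh (rho s))); [intro; apply coshN|].
  apply (smooth1_comp cosh); [apply smooth1_cosh | exact rho_smooth]. }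
assert (sin_smooth : smooth1 (fun s => sin (chi s))).
{ now apply (smooth1_comp sin); [apply smooth1_sin|]. }
(* The Fermi coordinate along the geodesic. A dilation of the half-plane normalizes it to 0 at [l],
   so that reflection about [l] is a plain sign change. *)
destruct (smooth1_antiderivative (fun s => sin (chi s) * / cosh (rho s)) l 0)
  as [p [p_derive [p_smooth p_l]]]; [now apply smooth1_mult|].
assert (p_opp : forall s, p (- s) = p s).
{ intro s; replace (- s) with (2 * 0 - s) by ring.
  apply (antiderivative_of_odd p _ 0 p_derive); intro t.
  replace (2 * 0 - t) with (- t) by ring; rewrite sin_opp, rho_opp, cosh_opp; ring. }
assert (p_refl : forall s, p (2 * l - s) = - p s).
{ intro s; replace (- p s) with (2 * p l - p s) by (rewrite p_l; ring).
  apply (antiderivative_of_even p _ l p_derive); intro t.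
  now rewrite sin_refl, rho_refl. }
(* The hyperbolic curvature in Fermi coordinates; it equals [k + cos Phi] for the [k] and [Phi] set
   below. *)
set (kappa := fun s => c s + sin (chi s) * tanh (rho s)).
assert (kappa_smooth : smooth1 (fun s => kappa s ^ 2)).
{ assert (S : smooth1 kappa).
  { apply smooth1_plus; [exact c_smooth|]; apply smooth1_mult; [exact sin_smooth|].
    apply (smooth1_comp tanh); [apply smooth1_tanh | exact rho_smooth]. }
  apply (smooth1_ext (fun s => kappa s * kappa s)); [intro; ring|].
  now apply smooth1_mult. }
destruct (smooth1_antiderivative (fun s => kappa s ^ 2) 0 0)
  as [K [K_derive [K_smooth K_0]]]; [exact kappa_smooth|].
assert (K_opp : forall s, K (- s) = - K s).
{ intro s; replace (- s) with (2 * 0 - s) by ring.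
  replace (- K s) with (2 * K 0 - K s) by (rewrite K_0; ring).
  apply (antiderivative_of_even K _ 0 K_derive).
  intro t; replace (2 * 0 - t) with (- t) by ring; unfold kappa.
  rewrite c_even, sin_opp, rho_opp, tanh_opp; ring. }
assert (K_refl : forall s, K (2 * l - s) = 2 * K l - K s).
{ apply (antiderivative_of_even K _ l K_derive); intro t; unfold kappa.
  now rewrite c_refl, sin_refl, rho_refl. }
(* Translation by a full period is the reflection about 0 followed by the one about [l], done twice;
   hence the symmetries alone close the curve. *)
assert (shift : forall s, s + 4 * l = 2 * l - - (2 * l - - s)) by (intro; ring).
(* From Fermi to half-plane coordinates: [x = exp p * tanh rho], [y = exp p / cosh rho], and the
   tangent angle is [chi] corrected by the inclination of the Fermi frame. *)
set (x := fun s => exp (p s) * tanh (rho s)).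
set (q := fun s => p s - ln (cosh (rho s))).
set (Phi := fun s => chi s - atan (sinh (rho s))).
set (k := fun s => c s - cos (chi s) * / cosh (rho s)).
assert (cosPhi : forall s, cos (Phi s) =
  cos (chi s) * / cosh (rho s) + sin (chi s) * tanh (rho s)).
{ intro s; unfold Phi; now rewrite cos_minus, cos_gd, sin_gd. }
assert (sinPhi : forall s, sin (Phi s) =
  sin (chi s) * / cosh (rho s) - cos (chi s) * tanh (rho s)).
{ intro s; unfold Phi; now rewrite sin_minus, cos_gd, sin_gd. }
assert (exp_q : forall s, exp (q s) = exp (p s) * / cosh (rho s)).
{ intro s; unfold q, Rminus.
  rewrite exp_plus, exp_Ropp, exp_ln; [easy | apply cosh_pos]. }
assert (dx : forall s, is_derive x s (exp (q s) * cos (Phi s))).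
{ intro s; rewrite exp_q, cosPhi; unfold x, tanh.
  assert (ex_derive p s /\ ex_derive rho s) as [E1 E2].
  { split; eexists; [apply p_derive | apply rho_derive]. }
  auto_derive; [now repeat split|].
  replace (Derive (fun x : R => p x) s) with (sin (chi s) * / cosh (rho s))
    by (symmetry; apply is_derive_unique, p_derive).
  replace (Derive (fun x : R => rho x) s) with (cos (chi s))
    by (symmetry; apply is_derive_unique, rho_derive).
  generalize (cosh2_sinh2 (rho s)); intro E.
  replace (cosh (rho s) * (cosh (rho s) * 1)) with (cosh (rho s) ^ 2) by ring.
  transitivity (exp (p s) * (sin (chi s) * sinh (rho s) + cos (chi s) *
    (cosh (rho s) ^ 2 - sinh (rho s) ^ 2)) / cosh (rho s) ^ 2).
  - field; apply coshN.
  - replace (cosh (rho s) ^ 2 - sinh (rho s) ^ 2) with 1 by lra.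
    field; apply coshN. }
assert (dq : forall s, is_derive q s (sin (Phi s))).
{ intro s; rewrite sinPhi; unfold q, tanh.
  assert (ex_derive p s /\ ex_derive rho s) as [E1 E2].
  { split; eexists; [apply p_derive | apply rho_derive]. }
  auto_derive; [repeat split; try assumption; apply cosh_pos|].
  replace (Derive (fun x : R => p x) s) with (sin (chi s) * / cosh (rho s))
    by (symmetry; apply is_derive_unique, p_derive).
  replace (Derive (fun x : R => rho x) s) with (cos (chi s))
    by (symmetry; apply is_derive_unique, rho_derive).
  field; apply coshN. }
assert (dPhi : forall s, is_derive Phi s (k s)).
{ intro s; unfold Phi, k.
  assert (ex_derive chi s /\ ex_derive rho s) as [E1 E2].
  { split; eexists; [apply chi_derive | apply rho_derive]. }
  auto_derive; [now repeat split|].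
  replace (Derive (fun x : R => chi x) s) with (c s)
    by (symmetry; apply is_derive_unique, chi_derive).
  replace (Derive (fun x : R => rho x) s) with (cos (chi s))
    by (symmetry; apply is_derive_unique, rho_derive).
  replace (1 + sinh (rho s) * (sinh (rho s) * 1)) with (cosh (rho s) ^ 2)
    by (rewrite cosh2_sinh2; ring).
  field; apply coshN. }
assert (Phi_smooth : smooth1 Phi).
{ apply smooth1_minus; [exact chi_smooth|].
  apply (smooth1_comp atan); [apply smooth1_atan|].
  apply (smooth1_comp sinh); [apply smooth1_sinh | exact rho_smooth]. }
assert (q_smooth : smooth1 q).
{ apply (smooth1_of_derive _ _ dq).
  now apply (smooth1_comp sin); [apply smooth1_sin|]. }
exists x, q, Phi, k; split; [|split; [exact q_smooth|split; [exact Phi_smooth|]]].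
{ apply (smooth1_of_derive _ _ dx), smooth1_mult.
  - now apply (smooth1_comp exp); [apply smooth1_exp|].
  - now apply (smooth1_comp cos); [apply smooth1_cos|]. }
split; [exact dx|split; [exact dq|split; [exact dPhi|]]].
split; [|split].
- intro s; unfold x; rewrite shift.
  rewrite p_refl, p_opp, p_refl, p_opp, rho_refl, rho_opp, rho_refl, rho_opp.
  now rewrite 2!Ropp_involutive.
- intro s; unfold q; rewrite shift.
  rewrite p_refl, p_opp, p_refl, p_opp, rho_refl, rho_opp, rho_refl, rho_opp.
  now rewrite 2!Ropp_involutive.
- assert (RK : RInt (fun s => kappa s ^ 2) 0 l = K l).
  { apply is_RInt_unique; evar_last.
    - apply (is_RInt_derive K (fun s => kappa s ^ 2)); [intros; apply K_derive|].
      intros; now apply (smooth1_continuous (fun s => kappa s ^ 2)).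
    - unfold minus, plus, opp; simpl; rewrite K_0; ring. }
  change (RInt _ 0 l) with (RInt (fun s => kappa s ^ 2) 0 l); rewrite RK.
  apply is_RInt_unique; evar_last.
  (* Since [(k - cos Phi) ^ 2 = (k + cos Phi) ^ 2 - 4 * k * cos Phi] and [k = Phi'], this is a
     primitive of the integrand. *)
  + apply (is_RInt_derive (fun s => K s - 4 * sin (Phi s))
      (fun s => (k s - cos (Phi s)) ^ 2)).
    * intros s _.
      replace ((k s - cos (Phi s)) ^ 2) with
        (kappa s ^ 2 - 4 * (k s * cos (Phi s))).
      2:{ replace (kappa s) with (k s + cos (Phi s)); [ring|].
          rewrite cosPhi; unfold k, kappa; ring. }
      apply (is_derive_minus K (fun s => 4 * sin (Phi s))); [apply K_derive|].
      apply (is_derive_scal (fun s => sin (Phi s))).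
      apply (is_derive_comp sin Phi); [apply is_derive_sin | apply dPhi].
    * intros s _.
      apply (smooth1_continuous (fun s => (k s - cos (Phi s)) ^ 2)).
      apply (smooth1_ext (fun s => (k s - cos (Phi s)) * (k s - cos (Phi s))));
        [intro; ring|].
      assert (smooth1 (fun s => k s - cos (Phi s))).
      { apply smooth1_minus.
        - apply smooth1_minus; [exact c_smooth|]; apply smooth1_mult;
            [|exact sech_smooth].
          now apply (smooth1_comp cos); [apply smooth1_cos|].
        - now apply (smooth1_comp cos); [apply smooth1_cos|]. }
      now apply smooth1_mult.
  + unfold minus, plus, opp; simpl; rewrite K_0, 2!sinPhi.
    replace (4 * l) with (0 + 4 * l) by ring; rewrite shift.
    rewrite K_refl, K_opp, K_refl, K_opp, K_0.
    rewrite rho_refl, rho_opp, rho_refl, rho_opp.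
    rewrite sin_refl, sin_opp, sin_refl, sin_opp.
    rewrite chi_refl, chi_opp, chi_refl, chi_opp, 2!Ropp_involutive.
    (* Over the four quarters [chi] makes exactly one full turn. *)
    replace (PI - - (PI - - chi 0)) with (chi 0 + 2 * PI) by ring.
    rewrite cos_plus, cos_2PI, sin_2PI; ring.
Qed.

(** * Approximation by even trigonometric polynomials *)

(* The Bernstein operator, as the expectation of [phi] at the number of
   successes in [n] independent trials of success probability [x]. *)
Fixpoint bernstein (n : nat) (phi : nat -> R) (x : R) : R :=
  match n with
  | O => phi O
  | S m => x * bernstein m (fun k => phi (S k)) x + (1 - x) * bernstein m phi x
  end.

Lemma bernstein_le n phi psi x :
  0 <= x <= 1 -> (forall k, (k <= n)%nat -> phi k <= psi k) ->
  bernstein n phi x <= bernstein n psi x.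
Proof.
intro Hx; revert phi psi; induction n as [|n IH]; intros phi psi H; simpl.
- now apply H.
- apply Rplus_le_compat; (apply Rmult_le_compat_l; [lra|]); apply IH;
    intros k Hk; apply H; lia.
Qed.

Lemma bernstein_affine n phi psi a c x :
  (forall k, psi k = a + c * phi k) ->
  bernstein n psi x = a + c * bernstein n phi x.
Proof.
revert phi psi; induction n as [|n IH]; intros phi psi H; simpl; [apply H|].
rewrite (IH phi psi H), (IH (fun k => phi (S k)) (fun k => psi (S k))).
- ring.
- intro k; apply H.
Qed.

(** The binomial variance plus the squared distance of the mean from [c]. *)
Lemma bernstein_square n c x phi :
  (forall k, phi k = (INR k - c) ^ 2) ->
  bernstein n phi x = INR n * x * (1 - x) + (INR n * x - c) ^ 2.
Proof.
revert c phi; induction n as [|n IH]; intros c phi H.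
- simpl; rewrite H; simpl; ring.
- change (bernstein (S n) phi x) with
    (x * bernstein n (fun k => phi (S k)) x + (1 - x) * bernstein n phi x).
  rewrite (IH c phi H), (IH (c - 1) (fun k => phi (S k))), S_INR; [ring|].
  intro k; rewrite H, S_INR; ring.
Qed.

Lemma smooth1_bernstein n phi g :
  smooth1 g -> smooth1 (fun s => bernstein n phi (g s)).
Proof.
intro Hg; revert phi; induction n as [|n IH]; intro phi; simpl.
- apply smooth1_const.
- apply smooth1_plus; apply smooth1_mult; [exact Hg | apply IH | | apply IH].
  apply smooth1_minus; [apply smooth1_const | exact Hg].
Qed.

(** Chebyshev's argument: the quadratic bound is averaged, and the mean square deviation of [k / n]
    is [x * (1 - x) / n], at most [1 / (4 * n)]. *)
Lemma bernstein_error n phi x v a c :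
  (0 < n)%nat -> 0 <= x <= 1 -> 0 <= c ->
  (forall k, (k <= n)%nat -> Rabs (phi k - v) <= a + c * (INR k / INR n - x) ^ 2) ->
  Rabs (bernstein n phi x - v) <= a + c / (4 * INR n).
Proof.
intros Hn Hx Hc H.
assert (N : 0 < INR n) by now apply lt_0_INR.
set (sq := fun k => (INR k - INR n * x) ^ 2).
assert (E : bernstein n sq x = INR n * (x * (1 - x))).
{ rewrite (bernstein_square n (INR n * x) x sq); [ring | reflexivity]. }
assert (U : c / INR n ^ 2 * bernstein n sq x <= c / (4 * INR n)).
{ rewrite E; replace (c / INR n ^ 2 * (INR n * (x * (1 - x)))) with
    (c / INR n * (x * (1 - x))) by (field; lra).
  replace (c / (4 * INR n)) with (c / INR n * / 4) by (field; lra).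
  apply Rmult_le_compat_l; [|generalize (pow2_ge_0 (x - 1 / 2)); lra].
  apply Rmult_le_pos; [exact Hc | now apply Rlt_le, Rinv_0_lt_compat]. }
assert (D : forall k, c * (INR k / INR n - x) ^ 2 = c / INR n ^ 2 * sq k).
{ intro k; unfold sq; field; lra. }
assert (H1 : bernstein n phi x <= (v + a) + c / INR n ^ 2 * bernstein n sq x).
{ rewrite <- (bernstein_affine n sq (fun k => (v + a) + c / INR n ^ 2 * sq k))
    by reflexivity.
  apply bernstein_le; [exact Hx|]; intros k Hk.
  generalize (H k Hk); rewrite D; intro B; apply Rabs_le_between in B; lra. }
assert (H2 : (v - a) + - (c / INR n ^ 2) * bernstein n sq x <= bernstein n phi x).
{ rewrite <- (bernstein_affine n sq (fun k => (v - a) + - (c / INR n ^ 2) * sq k))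
    by reflexivity.
  apply bernstein_le; [exact Hx|]; intros k Hk.
  generalize (H k Hk); rewrite D; intro B; apply Rabs_le_between in B; lra. }
apply Rabs_le_between; lra.
Qed.

(** From [sin y >= y - y ^ 3 / 6] and [y <= 2], the latter by [PI <= 4]. *)
Lemma sin_ge_third y : 0 <= y <= PI / 2 -> y / 3 <= sin y.
Proof.
intros [H0 H1]; generalize PI_4; intro P.
destruct (pre_sin_bound y 0) as [B _]; [lra | lra |].
apply Rle_trans with (2 := B); unfold sin_approx, sin_term; simpl.
nra.
Qed.

Section CosinePolynomials.

Variable l : R.
Hypothesis l_gt0 : 0 < l.

(** Equal to [(1 - cos (PI * s / l)) / 2]: even about 0 and about [l], and increasing from 0 to 1 on
    [[0, l]]. Any polynomial in it inherits the two symmetries. *)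
Definition wave (s : R) : R := sin (PI / (2 * l) * s) * sin (PI / (2 * l) * s).

Lemma smooth1_wave : smooth1 wave.
Proof.
assert (smooth1 (fun s => sin (PI / (2 * l) * s))).
{ apply smooth1_dilate, smooth1_sin. }
now apply smooth1_mult.
Qed.

Lemma wave_even s : wave (- s) = wave s.
Proof.
unfold wave; replace (_ * - s) with (- (PI / (2 * l) * s)) by ring.
rewrite sin_neg; ring.
Qed.

Lemma wave_reflect s : wave (2 * l - s) = wave s.
Proof.
unfold wave.
replace (_ * (2 * l - s)) with (PI - PI / (2 * l) * s) by (field; lra).
now rewrite Rtrigo_facts.sin_pi_minus.
Qed.

Lemma wave_bound s : 0 <= wave s <= 1.
Proof.
unfold wave; generalize (SIN_bound (PI / (2 * l) * s)); intros; nra.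
Qed.

(** For [s <= t] and [a = PI / (2 * l)], the difference [wave t - wave s] is
    [sin (a * (t - s)) * sin (a * (t + s))], and both factors are at least [a * (t - s) / 3]. The
    separation is only quadratic because [wave] is flat at 0 and [l]; squaring gives the fourth
    power. *)
Lemma wave_separates s t :
  0 <= s <= l -> 0 <= t <= l ->
  (t - s) ^ 4 <= (6 * l / PI) ^ 4 * (wave t - wave s) ^ 2.
Proof.
generalize PI_RGT_0; intro P.
assert (H : forall s t, 0 <= s -> s <= t -> t <= l ->
  (t - s) ^ 2 <= (6 * l / PI) ^ 2 * (wave t - wave s)).
{ clear s t; intros s t Hs st Ht.
  set (a := PI / (2 * l)).
  assert (Ha : 0 < a) by (apply Rdiv_lt_0_compat; lra).
  assert (Hal : a * l = PI / 2) by (unfold a; field; lra).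
  assert (E : wave t - wave s = sin (a * (t - s)) * sin (a * (t + s))).
  { unfold wave; fold a.
    replace (a * (t - s)) with (a * t - a * s) by ring.
    replace (a * (t + s)) with (a * t + a * s) by ring.
    rewrite sin_minus, sin_plus.
    generalize (cos2_sin2 (a * t)) (cos2_sin2 (a * s)); nra. }
  assert (a0 : 0 <= a * s) by nra.
  assert (a1 : a * s <= a * t) by nra.
  assert (a2 : a * t <= PI / 2) by (rewrite <- Hal; nra).
  assert (G : a * (t - s) / 3 <= sin (a * (t - s))).
  { apply sin_ge_third; split; nra. }
  assert (G2 : sin (a * (t - s)) <= sin (a * (t + s))).
  { assert (F : sin (a * (t + s)) - sin (a * (t - s)) = 2 * cos (a * t) * sin (a * s)).
    { rewrite form4.
      replace ((a * (t + s) + a * (t - s)) / 2) with (a * t) by field.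
      now replace ((a * (t + s) - a * (t - s)) / 2) with (a * s) by field. }
    assert (0 <= cos (a * t)) by (apply cos_ge_0; lra).
    assert (0 <= sin (a * s)) by (apply sin_ge_0; lra).
    nra. }
  assert (0 <= a * (t - s) / 3) by nra.
  rewrite E; apply Rle_trans with ((6 * l / PI) ^ 2 * (a * (t - s) / 3) ^ 2).
  - apply Req_le; unfold a; field; lra.
  - apply Rmult_le_compat_l; [apply pow2_ge_0 | nra]. }
assert (S4 : forall u v w : R, 0 <= v -> u ^ 2 <= v * w -> u ^ 4 <= v ^ 2 * w ^ 2).
{ intros u v w Hv Huw; replace (u ^ 4) with (u ^ 2 * u ^ 2) by ring.
  replace (v ^ 2 * w ^ 2) with ((v * w) * (v * w)) by ring.
  generalize (pow2_ge_0 u); intro; now apply Rmult_le_compat. }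
intros Hs Ht; replace ((6 * l / PI) ^ 4) with (((6 * l / PI) ^ 2) ^ 2) by ring.
destruct (Rle_dec s t) as [st|st].
- apply S4; [apply pow2_ge_0 | now apply H].
- replace ((t - s) ^ 4) with ((s - t) ^ 4) by ring.
  replace ((wave t - wave s) ^ 2) with ((wave s - wave t) ^ 2) by ring.
  apply S4; [apply pow2_ge_0 | apply H; lra].
Qed.

(** The inverse of [wave] on [[0, l]], evaluated at [k / n]. *)
Definition node (n k : nat) : R := 2 * l / PI * asin (sqrt (INR k / INR n)).

Lemma node_spec n k :
  (0 < n)%nat -> (k <= n)%nat ->
  0 <= node n k <= l /\ wave (node n k) = INR k / INR n.
Proof.
intros Hn Hk; generalize PI_RGT_0; intro P.
assert (N : 0 < INR n) by now apply lt_0_INR.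
assert (K : 0 <= INR k <= INR n) by (split; [apply pos_INR | now apply le_INR]).
assert (Q : 0 <= INR k / INR n <= 1).
{ split; [apply Rdiv_le_0_compat; lra|].
  apply Rmult_le_reg_r with (1 := N); unfold Rdiv.
  rewrite Rmult_assoc, Rinv_l; lra. }
assert (S0 := sqrt_pos (INR k / INR n)).
assert (SS := sqrt_sqrt _ (proj1 Q)).
assert (S1 : sqrt (INR k / INR n) <= 1) by (apply Rnot_lt_le; intro; nra).
unfold wave, node; set (t := asin _).
assert (St : sin t = sqrt (INR k / INR n)) by (apply sin_asin; lra).
assert (Bt := asin_bound (sqrt (INR k / INR n))); fold t in Bt.
assert (Pt : 0 <= t).
{ apply Rnot_lt_le; intro Ht.
  assert (sin t < 0) by (apply sin_lt_0_var; lra); lra. }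
assert (lP : 0 < 2 * l / PI) by (apply Rdiv_lt_0_compat; lra).
split; [split|].
- nra.
- replace l with (2 * l / PI * (PI / 2)) at 2 by (field; lra).
  apply Rmult_le_compat_l; lra.
- replace (PI / (2 * l) * (2 * l / PI * t)) with t by (field; lra).
  now rewrite St.
Qed.

(** The Bernstein polynomial of [h] composed with the inverse of [wave], taken at [wave s]. As [h]
    may jump, closeness is claimed only at points [s] with a Lipschitz bound against all of
    [[0, l]], while the uniform bound survives everywhere. *)
Lemma cosine_polynomial_approximation (h : R -> R) (M K eta : R) :
  (forall s, 0 <= s <= l -> Rabs (h s) <= M) -> 0 <= K -> 0 < eta ->
  exists c, smooth1 c /\ (forall s, c (- s) = c s) /\
    (forall s, c (2 * l - s) = c s) /\
    (forall s, Rabs (c s) <= M) /\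
    forall s, 0 <= s <= l ->
      (forall t, 0 <= t <= l -> Rabs (h t - h s) <= K * Rabs (t - s)) ->
      Rabs (c s - h s) <= eta.
Proof.
intros HM HK Heta; generalize PI_RGT_0; intro P.
set (Q := (6 * l / PI) ^ 4).
assert (Q0 : 0 <= Q).
{ unfold Q; apply pow_le, Rlt_le, Rdiv_lt_0_compat; lra. }
(* [K * d] takes up half of [eta]; [n] is then chosen so large that the averaged term [B / (4 * n)]
   takes up at most the other half. *)
set (d := eta / (2 * (K + 1))).
assert (d0 : 0 < d) by (apply Rdiv_lt_0_compat; lra).
assert (d3 : 0 < d ^ 3) by now apply pow_lt.
set (B := K * Q / d ^ 3).
assert (B0 : 0 <= B).
{ apply Rmult_le_pos; [nra | now apply Rlt_le, Rinv_0_lt_compat]. }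
destruct (INR_unbounded (B / eta)) as [m Hm].
set (n := S m).
assert (Hn : (0 < n)%nat) by (unfold n; lia).
assert (N : 0 < INR n) by now apply lt_0_INR.
assert (NB : B / (4 * INR n) <= eta / 2).
{ apply Rmult_lt_compat_r with (r := eta) in Hm; [|exact Heta].
  unfold Rdiv in Hm; rewrite Rmult_assoc, Rinv_l, Rmult_1_r in Hm by lra.
  assert (INR n = INR m + 1) by (unfold n; apply S_INR).
  apply Rmult_le_reg_r with (4 * INR n); [lra|].
  unfold Rdiv; rewrite Rmult_assoc, Rinv_l; nra. }
exists (fun s => bernstein n (fun k => h (node n k)) (wave s)).
split; [apply smooth1_bernstein, smooth1_wave|].
split; [intro s; now rewrite wave_even|].
split; [intro s; now rewrite wave_reflect|].
split.
(* An average of values bounded by [M]: the error estimate with [v = 0] and no quadratic term. *)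
- intro s; replace M with (M + 0 / (4 * INR n)) by (field; lra).
  rewrite <- (Rminus_0_r (bernstein _ _ _)).
  apply bernstein_error; [exact Hn | apply wave_bound | lra |].
  intros k Hk; rewrite Rminus_0_r, Rmult_0_l, Rplus_0_r.
  apply HM, (node_spec n k Hn Hk).
- intros s Hs HL; apply Rle_trans with (K * d + B / (4 * INR n)).
  + apply bernstein_error; [exact Hn | apply wave_bound | exact B0 |].
    intros k Hk; destruct (node_spec n k Hn Hk) as [Hk1 <-].
    apply Rle_trans with (1 := HL _ Hk1).
    generalize (wave_separates s (node n k) Hs Hk1); fold Q.
    set (y := Rabs (node n k - s)); intro W.
    assert (y0 : 0 <= y) by apply Rabs_pos.
    replace ((node n k - s) ^ 4) with (y ^ 4) in W.
    2:{ unfold y; replace (Rabs (node n k - s) ^ 4) with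
          ((Rabs (node n k - s) ^ 2) ^ 2) by ring.
        rewrite pow2_abs; ring. }
    (* Trades the linear bound for a fourth power, which [wave_separates] converts into the square
       that the averaging controls. *)
    assert (Y : y <= d + y ^ 4 / d ^ 3).
    { assert (y * d ^ 3 <= d ^ 4 + y ^ 4).
      { destruct (Rle_dec y d) as [yd|yd].
        - generalize (pow_le y 4 y0); nra.
        - assert (d ^ 3 <= y ^ 3) by (apply pow_incr; lra).
          generalize (pow_lt d 4 d0); nra. }
      apply Rmult_le_reg_r with (1 := d3); rewrite Rmult_plus_distr_r.
      unfold Rdiv; rewrite Rmult_assoc, Rinv_l, Rmult_1_r; nra. }
    apply Rle_trans with (K * (d + y ^ 4 / d ^ 3)); [now apply Rmult_le_compat_l|].
    apply Rle_trans with (K * (d + (Q * (wave (node n k) - wave s) ^ 2) / d ^ 3)).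
    * apply Rmult_le_compat_l; [exact HK|]; apply Rplus_le_compat_l.
      apply Rmult_le_compat_r; [now apply Rlt_le, Rinv_0_lt_compat | exact W].
    * apply Req_le; unfold B; field; lra.
  + assert (K * d <= eta / 2).
    { unfold d; apply Rmult_le_reg_r with (2 * (K + 1)); [lra|].
      replace (K * (eta / (2 * (K + 1))) * (2 * (K + 1))) with (K * eta)
        by (field; lra).
      nra. }
    lra.
Qed.

End CosinePolynomials.

(** * Catenary and geodesic *)

Lemma derive_le_increment (F G f g : R -> R) (a b : R) :
  a <= b ->
  (forall s, a <= s <= b -> is_derive F s (f s)) ->
  (forall s, a <= s <= b -> is_derive G s (g s)) ->
  (forall s, a <= s <= b -> f s <= g s) ->
  F b - F a <= G b - G a.
Proof.
intros ab DF DG fg.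
assert (mM : Rmin a b = a /\ Rmax a b = b).
{ now split; [apply Rmin_left | apply Rmax_right]. }
destruct mM as [mE ME].
assert (D : forall s, a <= s <= b -> is_derive (fun s => G s - F s) s (g s - f s)).
{ intros s Hs; apply (is_derive_minus G F); [now apply DG | now apply DF]. }
destruct (MVT_gen (fun s => G s - F s) a b (fun s => g s - f s)) as [c [Hc E]].
- rewrite mE, ME; intros s Hs; apply D; lra.
- rewrite mE, ME; intros s Hs; apply continuity_pt_filterlim.
  apply (ex_derive_continuous (fun s => G s - F s)); eexists; now apply D.
- rewrite mE, ME in Hc; generalize (fg c Hc); simpl in E; nra.
Qed.

Lemma derive_bound_increment (F f : R -> R) (k a b : R) :
  a <= b ->
  (forall s, a <= s <= b -> is_derive F s (f s)) ->
  (forall s, a <= s <= b -> Rabs (f s) <= k) ->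
  Rabs (F b - F a) <= k * (b - a).
Proof.
intros ab D H.
assert (L : forall m s, is_derive (fun s => m * s) s m).
{ intros m s; auto_derive; [easy | ring]. }
assert (H1 := derive_le_increment F (fun s => k * s) f (fun _ => k) a b ab D
  (fun s _ => L k s)).
assert (H2 := derive_le_increment (fun s => - k * s) F (fun _ => - k) f a b ab
  (fun s _ => L (- k) s) D).
simpl in H1, H2; apply Rabs_le_between; split.
- apply Rle_trans with (- k * b - - k * a); [lra|]; apply H2; intros s Hs.
  generalize (H s Hs); intro B; apply Rabs_le_between in B; lra.
- apply Rle_trans with (k * b - k * a); [|lra]; apply H1; intros s Hs.
  generalize (H s Hs); intro B; apply Rabs_le_between in B; lra.
Qed.

Lemma derive_bound_lipschitz (F f : R -> R) (k a b : R) :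
  (forall s, is_derive F s (f s)) ->
  (forall s, Rabs (f s) <= k) -> Rabs (F b - F a) <= k * Rabs (b - a).
Proof.
intros D H; destruct (Rle_dec a b) as [ab|ab].
- rewrite (Rabs_pos_eq (b - a)) by lra.
  now apply (derive_bound_increment F f).
- rewrite (Rabs_minus_sym (F b)), (Rabs_minus_sym b).
  rewrite (Rabs_pos_eq (a - b)) by lra.
  apply (derive_bound_increment F f); auto; lra.
Qed.

Lemma sin_lipschitz a b : Rabs (sin b - sin a) <= Rabs (b - a).
Proof.
rewrite <- (Rmult_1_l (Rabs (b - a))).
apply (derive_bound_lipschitz sin cos); [exact is_derive_sin|].
intro s; apply Rabs_le_between, COS_bound.
Qed.

Lemma cos_lipschitz a b : Rabs (cos b - cos a) <= Rabs (b - a).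
Proof.
rewrite <- (Rmult_1_l (Rabs (b - a))).
apply (derive_bound_lipschitz cos (fun s => - sin s)); [exact is_derive_cos|].
intro s; rewrite Rabs_Ropp; apply Rabs_le_between, SIN_bound.
Qed.

Lemma sech_bound t : 0 < / cosh t <= 1.
Proof.
assert (H : 1 <= cosh t) by (generalize (cosh2_sinh2 t) (cosh_pos t); nra).
split; [apply Rinv_0_lt_compat, cosh_pos|].
rewrite <- Rinv_1; apply Rinv_le_contravar; lra.
Qed.

Lemma tanh2_sech2 t : tanh t ^ 2 = 1 - (/ cosh t) ^ 2.
Proof.
generalize (cosh_pos t) (cosh2_sinh2 t); intros H E; unfold tanh.
replace ((sinh t / cosh t) ^ 2) with ((cosh t ^ 2 - 1) / cosh t ^ 2).
- field; lra.
- replace (cosh t ^ 2 - 1) with (sinh t ^ 2) by lra; field; lra.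
Qed.

Lemma tanh_bound t : Rabs (tanh t) <= 1.
Proof.
apply Rabs_le_between; generalize (tanh2_sech2 t) (sech_bound t); nra.
Qed.

Lemma is_derive_tanh t : is_derive tanh t ((/ cosh t) ^ 2).
Proof.
generalize (cosh_pos t) (cosh2_sinh2 t); intros H E; unfold tanh.
auto_derive; [lra|].
transitivity ((cosh t ^ 2 - sinh t ^ 2) / cosh t ^ 2); [field; lra|].
replace (cosh t ^ 2 - sinh t ^ 2) with 1 by lra.
field; lra.
Qed.

Lemma tanh_lipschitz a b : Rabs (tanh b - tanh a) <= Rabs (b - a).
Proof.
rewrite <- (Rmult_1_l (Rabs (b - a))).
apply (derive_bound_lipschitz tanh (fun t => (/ cosh t) ^ 2)); [exact is_derive_tanh|].
intro s; apply Rabs_le_between; generalize (sech_bound s); nra.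
Qed.

Lemma is_derive_gd (t : R) : is_derive (fun s => atan (sinh s)) t (/ cosh t).
Proof.
generalize (cosh_pos t) (cosh2_sinh2 t); intros H E.
auto_derive; [easy|].
replace (1 + sinh t * (sinh t * 1)) with (cosh t ^ 2) by lra.
field; lra.
Qed.

Lemma is_derive_arcsinh (F : R -> R) (s f : R) :
  is_derive F s f ->
  is_derive (fun s => arcsinh (F s)) s (f / cosh (arcsinh (F s))).
Proof.
intro D; evar_last.
- apply (is_derive_comp arcsinh F); [|exact D].
  apply is_derive_Reals, derivable_pt_lim_arcsinh.
- unfold scal; simpl; unfold mult; simpl.
  rewrite <- (sqrt_1_sinh2 (arcsinh (F s))), sinh_arcsinh.
  replace (F s * (F s * 1) + 1) with (1 + (F s)²) by (unfold Rsqr; ring).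
  reflexivity.
Qed.

(* The catenary [(s, cosh s)] in arclength, in Fermi coordinates along its axis.
   [cat_chi] adds the Euclidean tangent angle [atan (sinh s)] and the
   inclination [atan (sinh rho)] of the Fermi frame. *)
Definition cat_rho (s : R) : R := arcsinh (s * / cosh s).
Definition cat_chi (s : R) : R := atan (sinh s) + atan (sinh (cat_rho s)).
Definition cat_rate (s : R) : R :=
  / cosh s + / cosh (cat_rho s) * cos (cat_chi s).

Lemma is_derive_cat_rho s : is_derive cat_rho s (cos (cat_chi s)).
Proof.
unfold cat_chi; rewrite cos_plus, 2!cos_gd, 2!sin_gd.
generalize (cosh_pos s) (cosh_pos (cat_rho s)); intros H H1.
evar_last; [apply (is_derive_arcsinh (fun s => s * / cosh s))|].
- auto_derive; [lra | reflexivity].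
- fold (cat_rho s); unfold tanh at 2.
  assert (E : sinh (cat_rho s) = s * / cosh s) by apply sinh_arcsinh.
  rewrite E; unfold tanh; field; lra.
Qed.

Lemma is_derive_cat_chi s : is_derive cat_chi s (cat_rate s).
Proof.
apply (is_derive_plus (fun s => atan (sinh s)) (fun s => atan (sinh (cat_rho s)))).
- apply is_derive_gd.
- evar_last; [apply (is_derive_comp (fun t => atan (sinh t)) cat_rho)|].
  + apply is_derive_gd.
  + apply is_derive_cat_rho.
  + unfold scal; simpl; unfold mult; simpl; ring.
Qed.

(** [cat_chi - atan (sinh cat_rho)] is the Euclidean tangent angle [atan (sinh s)], whose cosine is
    [/ cosh s]; expanding that cosine gives the claim. *)
Lemma cat_curvature s :
  cat_rate s + sin (cat_chi s) * tanh (cat_rho s) = 2 * / cosh s.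
Proof.
assert (E : cos (cat_chi s - atan (sinh (cat_rho s))) = / cosh s).
{ rewrite <- (cos_gd s); f_equal; unfold cat_chi; ring. }
rewrite cos_minus, cos_gd, sin_gd in E; unfold cat_rate; lra.
Qed.

Lemma Rabs_mult_le x y a b : Rabs x <= a -> Rabs y <= b -> Rabs (x * y) <= a * b.
Proof.
intros Hx Hy; rewrite Rabs_mult; apply Rmult_le_compat; auto using Rabs_pos.
Qed.

Lemma Rabs_plus_le x y a b : Rabs x <= a -> Rabs y <= b -> Rabs (x + y) <= a + b.
Proof.
intros Hx Hy; apply Rle_trans with (1 := Rabs_triang x y); lra.
Qed.

Lemma Rabs_sin t : Rabs (sin t) <= 1.
Proof. apply Rabs_le_between, SIN_bound. Qed.

Lemma Rabs_cos t : Rabs (cos t) <= 1.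
Proof. apply Rabs_le_between, COS_bound. Qed.

Lemma Rabs_sech t : Rabs (/ cosh t) <= 1.
Proof. apply Rabs_le_between; generalize (sech_bound t); lra. Qed.

Lemma cat_rate_bound s : Rabs (cat_rate s) <= 2.
Proof.
replace 2 with (1 + 1 * 1) by ring.
apply Rabs_plus_le; [apply Rabs_sech|].
apply Rabs_mult_le; [apply Rabs_sech | apply Rabs_cos].
Qed.

Lemma is_derive_sech (F : R -> R) (s f : R) :
  is_derive F s f ->
  is_derive (fun s => / cosh (F s)) s (- (/ cosh (F s) * tanh (F s) * f)).
Proof.
intro D; generalize (cosh_pos (F s)); intro H.
evar_last.
- apply (is_derive_inv (fun s => cosh (F s))); [|lra].
  apply (is_derive_comp cosh F); [|exact D].
  apply is_derive_Reals, derivable_pt_lim_cosh.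
- unfold scal; simpl; unfold mult; simpl; unfold tanh; field; lra.
Qed.

Lemma cat_rate_lipschitz s t : Rabs (cat_rate t - cat_rate s) <= 4 * Rabs (t - s).
Proof.
apply (derive_bound_lipschitz cat_rate (fun s =>
  - (/ cosh s * tanh s * 1) +
  (- (/ cosh (cat_rho s) * tanh (cat_rho s) * cos (cat_chi s)) * cos (cat_chi s) +
   / cosh (cat_rho s) * (cat_rate s * - sin (cat_chi s))))).
- clear s t; intro s.
  apply (is_derive_plus (fun s => / cosh s)
    (fun s => / cosh (cat_rho s) * cos (cat_chi s))).
  + apply (is_derive_sech (fun s => s)); apply (is_derive_id s).
  + apply (is_derive_mult (fun s => / cosh (cat_rho s)) (fun s => cos (cat_chi s))).
    * apply is_derive_sech, is_derive_cat_rho.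
    * apply (is_derive_comp cos cat_chi); [apply is_derive_cos|].
      apply is_derive_cat_chi.
    * intros; apply Rmult_comm.
(* The sum mirrors the shape of the derivative: every factor is at most 1 in absolute value, except
   [cat_rate], at most 2. *)
- clear s t; intro s; replace 4 with (1 * 1 * 1 + ((1 * 1 * 1) * 1 + 1 * (2 * 1))) by ring.
  repeat first [apply cat_rate_bound | apply Rabs_sech | apply tanh_bound
    | apply Rabs_cos | apply Rabs_sin | rewrite Rabs_R1; lra
    | rewrite Rabs_Ropp | apply Rabs_plus_le | apply Rabs_mult_le].
Qed.

(* The geodesic [sinh rho = A cosh (l - s)], in arclength. *)
Definition geo_rho (A l s : R) : R := arcsinh (A * cosh (l - s)).
Definition geo_chi (A l s : R) : R :=
  PI / 2 + atan (A * sinh (l - s) / sqrt (1 + A ^ 2)).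
Definition geo_rate (A l s : R) : R :=
  - (sin (geo_chi A l s) * tanh (geo_rho A l s)).

(** Both follow from [cosh rho ^ 2 = 1 + A ^ 2 + A ^ 2 * sinh (l - s) ^ 2], which makes
    [cosh rho / sqrt (1 + A ^ 2)] the hypotenuse in the triangle of the arctangent. *)
Lemma geo_angle A l s :
  cos (geo_chi A l s) = - (A * sinh (l - s)) / cosh (geo_rho A l s) /\
  sin (geo_chi A l s) = sqrt (1 + A ^ 2) / cosh (geo_rho A l s).
Proof.
set (w := sqrt (1 + A ^ 2)).
assert (w2 : w ^ 2 = 1 + A ^ 2) by (apply pow2_sqrt; nra).
assert (w0 : 0 < w) by (apply sqrt_lt_R0; nra).
set (C := cosh (geo_rho A l s)).
assert (C0 : 0 < C) by apply cosh_pos.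
assert (C2 : C ^ 2 = 1 + A ^ 2 * cosh (l - s) ^ 2).
{ unfold C; rewrite cosh2_sinh2; unfold geo_rho; rewrite sinh_arcsinh; ring. }
assert (E : sqrt (1 + (A * sinh (l - s) / w)²) = C / w).
{ apply sqrt_lem_1.
  - generalize (Rle_0_sqr (A * sinh (l - s) / w)); lra.
  - now apply Rlt_le, Rdiv_lt_0_compat.
  - replace (C / w * (C / w)) with (C ^ 2 / w ^ 2) by (field; lra).
    unfold Rsqr; rewrite C2, cosh2_sinh2.
    replace (1 + A * sinh (l - s) / w * (A * sinh (l - s) / w)) with
      ((w ^ 2 + A ^ 2 * sinh (l - s) ^ 2) / w ^ 2) by (field; lra).
    rewrite w2; f_equal; ring. }
unfold geo_chi; fold w; rewrite cos_plus, sin_plus, cos_PI2, sin_PI2.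
rewrite sin_atan, cos_atan, E; split; field; lra.
Qed.

Lemma is_derive_geo_rho A l s :
  is_derive (geo_rho A l) s (cos (geo_chi A l s)).
Proof.
rewrite (proj1 (geo_angle A l s)); unfold geo_rho.
apply (is_derive_arcsinh (fun s => A * cosh (l - s))).
auto_derive; [easy | unfold Rminus; ring].
Qed.

(** Says that the curve is a geodesic: its rotation rate and [sin chi * tanh rho] add up to
    curvature zero. *)
Lemma is_derive_geo_chi A l s :
  is_derive (geo_chi A l) s (geo_rate A l s).
Proof.
unfold geo_rate; rewrite (proj2 (geo_angle A l s)); unfold geo_chi, tanh.
set (w := sqrt (1 + A ^ 2)).
assert (w2 : w ^ 2 = 1 + A ^ 2) by (apply pow2_sqrt; nra).
assert (w0 : 0 < w) by (apply sqrt_lt_R0; nra).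
set (C := cosh (geo_rho A l s)).
assert (C0 : 0 < C) by apply cosh_pos.
assert (C2 : C ^ 2 = 1 + A ^ 2 * cosh (l - s) ^ 2).
{ unfold C; rewrite cosh2_sinh2; unfold geo_rho; rewrite sinh_arcsinh; ring. }
assert (E : sinh (geo_rho A l s) = A * cosh (l - s)) by apply sinh_arcsinh.
rewrite E; auto_derive; [easy|].
replace (l + - s) with (l - s) by ring.
transitivity (- (A * cosh (l - s)) * w / (w ^ 2 + A ^ 2 * sinh (l - s) ^ 2)).
- field; split; [|lra].
  apply Rgt_not_eq; generalize (pow2_ge_0 (A * sinh (l - s))); nra.
- replace (w ^ 2 + A ^ 2 * sinh (l - s) ^ 2) with (C ^ 2)
    by (rewrite C2, w2, cosh2_sinh2; ring).
  field; lra.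
Qed.

Lemma geo_rate_bound A l s : Rabs (geo_rate A l s) <= 1.
Proof.
unfold geo_rate; rewrite Rabs_Ropp; replace 1 with (1 * 1) by ring.
apply Rabs_mult_le; [apply Rabs_sin | apply tanh_bound].
Qed.

Lemma geo_rate_lipschitz A l s t :
  Rabs (geo_rate A l t - geo_rate A l s) <= 4 * Rabs (t - s).
Proof.
apply Rle_trans with (2 * Rabs (t - s)); [|generalize (Rabs_pos (t - s)); lra].
apply (derive_bound_lipschitz (geo_rate A l) (fun s =>
  - ((geo_rate A l s * cos (geo_chi A l s)) * tanh (geo_rho A l s) +
     sin (geo_chi A l s) *
     (cos (geo_chi A l s) * (/ cosh (geo_rho A l s)) ^ 2)))).
- clear s t; intro s.
  apply (is_derive_opp (fun s => sin (geo_chi A l s) * tanh (geo_rho A l s))).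
  apply (is_derive_mult (fun s => sin (geo_chi A l s)) (fun s => tanh (geo_rho A l s))).
  + apply (is_derive_comp sin (geo_chi A l)); [apply is_derive_sin|].
    apply is_derive_geo_chi.
  + apply (is_derive_comp tanh (geo_rho A l)); [apply is_derive_tanh|].
    apply is_derive_geo_rho.
  + intros; apply Rmult_comm.
- clear s t; intro s; rewrite Rabs_Ropp; simpl.
  replace 2 with (1 * 1 * 1 + 1 * (1 * (1 * (1 * 1)))) by ring.
  repeat first [apply geo_rate_bound | apply Rabs_sech | apply tanh_bound
    | apply Rabs_cos | apply Rabs_sin | rewrite Rabs_R1; lra
    | apply Rabs_plus_le | apply Rabs_mult_le].
Qed.

(** * The junction of catenary and geodesic *)

Lemma tanh_exp t : tanh t * (exp t + exp (- t)) = exp t - exp (- t).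
Proof.
generalize (exp_pos t) (exp_pos (- t)); intros; unfold tanh, sinh, cosh; field; lra.
Qed.

(** The constants are matched to give [l * tanh l > 1] for [l >= 3 / 2], the sign needed at the
    right end when the junction is located. *)
Lemma tanh_ge_two_thirds t : 3 / 2 <= t -> 2 / 3 < tanh t.
Proof.
intro Ht.
assert (E : exp t * exp (- t) = 1).
{ rewrite <- exp_plus; replace (t + - t) with 0 by ring; apply exp_0. }
generalize (exp_ineq1 t); intro I.
assert (H : 5 / 2 < exp t) by lra.
generalize (exp_pos (- t)); intro P.
generalize (tanh_exp t); intro T.
apply Rnot_le_lt; intro; nra.
Qed.

Lemma tanh_lt_1 t : tanh t < 1.
Proof.
generalize (exp_pos t) (exp_pos (- t)) (tanh_exp t); intros.
apply Rnot_le_lt; intro; nra.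
Qed.

Lemma tanh_pos t : 0 < t -> 0 < tanh t.
Proof.
intro Ht; apply Rdiv_lt_0_compat; [|apply cosh_pos].
rewrite <- sinh_0; now apply sinh_lt.
Qed.

(* For a junction [s0] with [tanh (l - s0) = tanh s0 - 1 / s0], the catenary and
   the geodesic are tangent there. *)
Lemma junction_exists l :
  3 / 2 <= l ->
  exists s0 A, 0 < s0 < l /\ cat_rho s0 = geo_rho A l s0 /\
    cat_chi s0 = geo_chi A l s0.
Proof.
intro Hl.
(* A zero of [F] is a junction. [F 1 < 0] because [tanh 1 < 1] and [tanh (l - 1) > 0]; [F l > 0]
   because [l * tanh l > 1]. *)
set (F := fun s => s * (tanh s - tanh (l - s)) - 1).
destruct (IVT F 1 l) as [s0 [Hs E]].
- intro s; apply continuity_pt_filterlim.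
  apply (ex_derive_continuous F); unfold F, tanh.
  auto_derive; repeat split; apply Rgt_not_eq, cosh_pos.
- lra.
- unfold F; generalize (tanh_lt_1 1) (tanh_pos (l - 1)); intros; lra.
- unfold F; replace (l - l) with 0 by ring.
  replace (tanh 0) with 0
    by (unfold tanh; rewrite sinh_0; field; apply Rgt_not_eq, cosh_pos).
  generalize (tanh_ge_two_thirds l Hl); nra.
- assert (s0 <> l).
  { intros ->; unfold F in E; replace (l - l) with 0 in E by ring.
    replace (tanh 0) with 0 in E
      by (unfold tanh; rewrite sinh_0; field; apply Rgt_not_eq, cosh_pos).
    generalize (tanh_ge_two_thirds l Hl); nra. }
  (* Makes [sinh rho] agree at [s0] on both curves. *)
  set (A := s0 / (cosh s0 * cosh (l - s0))).
  generalize (cosh_pos s0) (cosh_pos (l - s0)); intros C0 C1.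
  exists s0, A; split; [lra|].
  assert (R : cat_rho s0 = geo_rho A l s0).
  { unfold cat_rho, geo_rho, A; f_equal; field; lra. }
  split; [exact R|].
  (* The junction equation gives equal cosines; both angles lie in [[0, PI]], where the cosine is
     injective. *)
  assert (cosE : cos (cat_chi s0) = cos (geo_chi A l s0)).
  { rewrite (proj1 (geo_angle A l s0)), <- R.
    unfold cat_chi; rewrite cos_plus, 2!cos_gd, 2!sin_gd.
    unfold tanh at 2; replace (sinh (cat_rho s0)) with (s0 * / cosh s0)
      by (symmetry; apply sinh_arcsinh).
    generalize (cosh_pos (cat_rho s0)); intro C2.
    replace (A * sinh (l - s0)) with (s0 / cosh s0 * tanh (l - s0))
      by (unfold A, tanh; field; lra).
    replace (s0 / cosh s0 * tanh (l - s0)) with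
      ((s0 * tanh s0 - 1) / cosh s0).
    2:{ unfold F in E; replace (s0 * tanh s0 - 1) with (s0 * tanh (l - s0)) by lra.
        field; lra. }
    field; lra. }
  assert (B1 : 0 <= cat_chi s0 <= PI).
  { assert (P : forall t, 0 <= t -> 0 <= atan t < PI / 2).
    { intros t Ht; split; [|apply atan_bound].
      destruct Ht as [Ht| <-]; [|rewrite atan_0; lra].
      rewrite <- atan_0; now apply Rlt_le, atan_increasing. }
    assert (0 < sinh s0) by (rewrite <- sinh_0; apply sinh_lt; lra).
    assert (0 <= sinh (cat_rho s0)).
    { unfold cat_rho; rewrite sinh_arcsinh.
      apply Rmult_le_pos; [lra | now apply Rlt_le, Rinv_0_lt_compat]. }
    generalize (P (sinh s0)) (P (sinh (cat_rho s0))); unfold cat_chi; lra. }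
  assert (B2 : 0 <= geo_chi A l s0 <= PI).
  { unfold geo_chi; generalize (atan_bound (A * sinh (l - s0) / sqrt (1 + A ^ 2))); lra. }
  rewrite <- (acos_cos _ B1), <- (acos_cos _ B2); now rewrite cosE.
Qed.

(** * Smoothing the model curve *)

Lemma Rabs_increment (F : R -> R) a b e k :
  Rabs (F a) <= e -> Rabs (F b - F a) <= k -> Rabs (F b) <= e + k.
Proof.
intros Ha Hk; replace (F b) with (F a + (F b - F a)) by ring.
now apply Rabs_plus_le.
Qed.

Lemma sin_tanh_lipschitz x r x' r' :
  Rabs (sin x * tanh r - sin x' * tanh r') <= Rabs (x - x') + Rabs (r - r').
Proof.
replace (sin x * tanh r - sin x' * tanh r') with
  ((sin x - sin x') * tanh r + sin x' * (tanh r - tanh r')) by ring.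
apply Rabs_plus_le.
- rewrite <- (Rmult_1_r (Rabs (x - x'))).
  apply Rabs_mult_le; [apply sin_lipschitz | apply tanh_bound].
- rewrite <- (Rmult_1_l (Rabs (r - r'))).
  apply Rabs_mult_le; [apply Rabs_sin | apply tanh_lipschitz].
Qed.

Lemma angle_stability (c h X Y : R -> R) (s1 s2 e k : R) :
  (forall s, is_derive X s (c s)) -> (forall s, is_derive Y s (h s)) ->
  Rabs (X s1 - Y s1) <= e ->
  (forall s, s1 <= s <= s2 -> Rabs (c s - h s) <= k) ->
  forall s, s1 <= s <= s2 -> Rabs (X s - Y s) <= e + k * (s - s1).
Proof.
intros DX DY H1 H2 s Hs.
apply (Rabs_increment (fun s => X s - Y s) s1); [exact H1|].
apply (derive_bound_increment (fun s => X s - Y s) (fun s => c s - h s)); [lra | |].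
- intros t _; now apply (is_derive_minus X Y).
- intros t Ht; apply H2; lra.
Qed.

(** The model curve, catenary up to [s0] and then geodesic, has energy [4 * tanh s0], strictly below
    4. Smoothing its rate at scale [tau] changes angle, distance and curvature by multiples of [tau]
    outside the window of radius [tau] about [s0], and inside it the curvature stays bounded; a
    small [tau] therefore preserves the strict inequality. *)
Lemma smooth_rotation_rate l :
  3 / 2 <= l ->
  exists c chi rho : R -> R,
    smooth1 c /\ (forall s, c (- s) = c s) /\ (forall s, c (2 * l - s) = c s) /\
    (forall s, is_derive chi s (c s)) /\ chi 0 = 0 /\ chi l = PI / 2 /\
    (forall s, is_derive rho s (cos (chi s))) /\ rho 0 = 0 /\
    RInt (fun s => (c s + sin (chi s) * tanh (rho s)) ^ 2) 0 l < 4.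
Proof.
intro Hl; destruct (junction_exists l Hl) as [s0 [A [Hs0 [R0 X0]]]].
set (X1 := cat_chi); set (R1 := cat_rho).
set (X2 := geo_chi A l); set (R2 := geo_rho A l).
(* The curvature error outside the window is at most [tau * B]: the first factor bounds the angle
   error divided by [tau], the second the passage from angle to curvature. *)
set (B := (2 * l + 8) * (4 + 2 * l)).
assert (B1 : 1 <= B) by (unfold B; nra).
set (gap := 4 - 4 * tanh s0).
assert (gap0 : 0 < gap) by (unfold gap; generalize (tanh_lt_1 s0); lra).
assert (Q0 : 0 < 6 * B * l + 32) by nra.
(* In the energy budget [6 * B * l] pays for the stretches outside the window, and [32 = 2 * 4 ^ 2]
   for the window of length [2 * tau] where the curvature is at most 4. *)
assert (T : exists tau, 0 < tau /\ tau * B <= 1 /\ tau * (6 * B * l + 32) < gap /\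
  tau <= s0 /\ tau <= l - s0).
{ set (t1 := Rmin (/ B) (gap / (2 * (6 * B * l + 32)))).
  set (t2 := Rmin s0 (l - s0)).
  assert (P1 : 0 < / B) by (apply Rinv_0_lt_compat; lra).
  assert (P2 : 0 < gap / (2 * (6 * B * l + 32))) by (apply Rdiv_lt_0_compat; lra).
  assert (P3 : 0 < t1) by now apply Rmin_pos.
  assert (P4 : 0 < t2) by (apply Rmin_pos; lra).
  assert (U1 : t1 <= / B) by apply Rmin_l.
  assert (U2 : t1 <= gap / (2 * (6 * B * l + 32))) by apply Rmin_r.
  assert (U3 : t2 <= s0) by apply Rmin_l.
  assert (U4 : t2 <= l - s0) by apply Rmin_r.
  exists (Rmin t1 t2).
  assert (V1 : Rmin t1 t2 <= t1) by apply Rmin_l.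
  assert (V2 : Rmin t1 t2 <= t2) by apply Rmin_r.
  split; [now apply Rmin_pos|]; split; [|split; [|split; lra]].
  - rewrite <- (Rinv_l B) by lra; apply Rmult_le_compat_r; lra.
  - apply Rle_lt_trans with (gap / (2 * (6 * B * l + 32)) * (6 * B * l + 32)).
    + apply Rmult_le_compat_r; lra.
    + replace (gap / (2 * (6 * B * l + 32)) * (6 * B * l + 32)) with (gap / 2)
        by (field; lra).
      lra. }
destruct T as [tau [tau0 [tauB [tauG [tau1 tau2]]]]].
set (h := fun s => if Rle_dec s s0 then cat_rate s else geo_rate A l s).
assert (h1 : forall s, s <= s0 -> h s = cat_rate s).
{ intros s Hs; unfold h; destruct (Rle_dec s s0); [easy | lra]. }
assert (h2 : forall s, s0 < s -> h s = geo_rate A l s).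
{ intros s Hs; unfold h; destruct (Rle_dec s s0); [lra | easy]. }
assert (h_bound : forall s, Rabs (h s) <= 2).
{ intro s; destruct (Rle_dec s s0).
  - rewrite h1 by lra; apply cat_rate_bound.
  - rewrite h2 by lra; generalize (geo_rate_bound A l s); lra. }
assert (itau : 0 < / tau) by now apply Rinv_0_lt_compat.
(* If [s] and [t] lie on different sides of the jump, then [tau <= Rabs (t - s)], and the crude
   bound 4 on the increment is at most [4 / tau] times the distance. *)
assert (h_lip : forall s t, tau <= Rabs (s - s0) ->
  Rabs (h t - h s) <= (4 + 4 * / tau) * Rabs (t - s)).
{ intros s t Hs; generalize (Rabs_pos (t - s)); intro P.
  assert (P4 : 0 <= / tau * Rabs (t - s)) by (apply Rmult_le_pos; lra).
  assert (far : tau <= Rabs (t - s) ->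
    Rabs (h t - h s) <= (4 + 4 * / tau) * Rabs (t - s)).
  { intro W; apply Rmult_le_compat_l with (r := / tau) in W; [|lra].
    rewrite Rinv_l in W by lra.
    apply Rle_trans with (2 + 2); [|lra].
    unfold Rminus; apply Rabs_plus_le; [|rewrite Rabs_Ropp]; apply h_bound. }
  destruct (Rle_dec s s0) as [ss|ss]; destruct (Rle_dec t s0) as [ts|ts].
  - rewrite !h1 by lra; generalize (cat_rate_lipschitz s t); lra.
  - apply far; rewrite Rabs_left1 in Hs by lra; rewrite Rabs_pos_eq; lra.
  - apply far; rewrite Rabs_pos_eq in Hs by lra; rewrite Rabs_left1; lra.
  - rewrite !h2 by lra; generalize (geo_rate_lipschitz A l s t); lra. }
destruct (cosine_polynomial_approximation l ltac:(lra) h 2 (4 + 4 * / tau) tau)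
  as [c0 [c0_smooth [c0_even [c0_refl [c0_bound c0_close]]]]];
  [intros; apply h_bound | lra | lra |].
destruct (smooth1_antiderivative c0 0 0 c0_smooth) as [X [dX [X_smooth X_0]]].
assert (close : forall s, 0 <= s <= l -> tau <= Rabs (s - s0) ->
  Rabs (c0 s - h s) <= tau).
{ intros s Hs Ht; apply c0_close; [exact Hs|]; intros t _; now apply h_lip. }
assert (rough : forall s v, Rabs v <= 2 -> Rabs (c0 s - v) <= 4).
{ intros s v Hv; replace 4 with (2 + 2) by ring; unfold Rminus.
  apply Rabs_plus_le; [apply c0_bound | now rewrite Rabs_Ropp]. }
assert (X1_0 : X1 0 = 0 /\ R1 0 = 0).
{ unfold X1, R1, cat_chi, cat_rho.
  rewrite Rmult_0_l, arcsinh_0, sinh_0, atan_0; lra. }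
set (e1 := tau * (2 * l + 8)).
(* The angle error grows at rate [tau] up to [s0 - tau], then at rate at most 4 over a length [tau].
   The same estimate is continued beyond [s0] against the geodesic. *)
assert (close1 : forall s, 0 <= s <= s0 -> Rabs (X s - X1 s) <= tau * (l + 4)).
{ assert (first : forall s, 0 <= s <= s0 - tau ->
    Rabs (X s - X1 s) <= 0 + tau * (s - 0)).
  { apply (angle_stability c0 cat_rate); [exact dX | exact is_derive_cat_chi | |].
    - rewrite X_0, (proj1 X1_0), Rminus_0_r, Rabs_R0; lra.
    - intros s Hs; rewrite <- h1 by lra; apply close; [lra|].
      rewrite Rabs_left1; lra. }
  intros s Hs; destruct (Rle_dec s (s0 - tau)) as [W|W].
  - apply Rle_trans with (1 := first s ltac:(lra)); nra.
  - assert (F := first (s0 - tau) ltac:(lra)).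
    apply Rle_trans with ((0 + tau * (s0 - tau - 0)) + 4 * (s - (s0 - tau))); [|nra].
    apply (angle_stability c0 cat_rate X X1 (s0 - tau) s0);
      [exact dX | exact is_derive_cat_chi | exact F | | lra].
    intros; apply rough, cat_rate_bound. }
assert (close2 : forall s, s0 <= s <= l -> Rabs (X s - X2 s) <= e1).
{ assert (first : forall s, s0 <= s <= s0 + tau ->
    Rabs (X s - X2 s) <= tau * (l + 4) + 4 * (s - s0)).
  { apply (angle_stability c0 (geo_rate A l));
      [exact dX | apply is_derive_geo_chi | |].
    - unfold X2; rewrite <- X0; apply close1; lra.
    - intros; apply rough; generalize (geo_rate_bound A l s); lra. }
  intros s Hs; unfold e1; destruct (Rle_dec s (s0 + tau)) as [W|W].
  - apply Rle_trans with (1 := first s ltac:(lra)); nra.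
  - assert (F := first (s0 + tau) ltac:(lra)).
    apply Rle_trans with
      ((tau * (l + 4) + 4 * (s0 + tau - s0)) + tau * (s - (s0 + tau))); [|nra].
    apply (angle_stability c0 (geo_rate A l) X X2 (s0 + tau) l);
      [exact dX | apply is_derive_geo_chi | exact F | | lra].
    intros t Ht; rewrite <- h2 by lra; apply close; [lra|].
    rewrite Rabs_pos_eq; lra. }
assert (X2_l : X2 l = PI / 2).
{ unfold X2, geo_chi; replace (l - l) with 0 by ring.
  rewrite sinh_0, Rmult_0_r; unfold Rdiv at 2; rewrite Rmult_0_l, atan_0; lra. }
(* The constant correction that makes the total rotation over [[0, l]] exactly [PI / 2]; adding it
   keeps the symmetries of the rate. *)
set (d := (PI / 2 - X l) / l).
assert (e1_pos : 0 <= e1) by (unfold e1; nra).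
assert (dl : Rabs (d * l) <= e1).
{ replace (d * l) with (- (X l - X2 l)) by (rewrite X2_l; unfold d; field; lra).
  rewrite Rabs_Ropp; apply close2; lra. }
assert (ds : forall s, 0 <= s <= l -> Rabs (d * s) <= e1).
{ intros s Hs; apply Rle_trans with (2 := dl).
  rewrite 2!Rabs_mult, (Rabs_pos_eq s), (Rabs_pos_eq l) by lra.
  apply Rmult_le_compat_l; [apply Rabs_pos | lra]. }
assert (d_bound : Rabs d <= e1).
{ rewrite <- (Rmult_1_r d); apply ds; lra. }
set (c := fun s => c0 s + d); set (chi := fun s => X s + d * s).
assert (c_smooth : smooth1 c) by (apply smooth1_plus; [exact c0_smooth | apply smooth1_const]).
assert (dchi : forall s, is_derive chi s (c s)).
{ intro s; apply (is_derive_plus X (fun s => d * s)); [apply dX|].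
  auto_derive; [easy | ring]. }
assert (chi_smooth : smooth1 chi) by now apply (smooth1_of_derive _ c).
destruct (smooth1_antiderivative (fun s => cos (chi s)) 0 0)
  as [rho [drho [rho_smooth rho_0]]].
{ now apply (smooth1_comp cos); [apply smooth1_cos|]. }
assert (chi1 : forall s, 0 <= s <= s0 -> Rabs (chi s - X1 s) <= 2 * e1).
{ intros s Hs; replace (chi s - X1 s) with ((X s - X1 s) + d * s) by (unfold chi; ring).
  replace (2 * e1) with (e1 + e1) by ring.
  apply Rabs_plus_le; [|apply ds; lra].
  apply Rle_trans with (1 := close1 s Hs); unfold e1; nra. }
assert (chi2 : forall s, s0 <= s <= l -> Rabs (chi s - X2 s) <= 2 * e1).
{ intros s Hs; replace (chi s - X2 s) with ((X s - X2 s) + d * s) by (unfold chi; ring).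
  replace (2 * e1) with (e1 + e1) by ring.
  apply Rabs_plus_le; [now apply close2 | apply ds; lra]. }
(* The cosine is 1-Lipschitz, so the angle error [2 * e1] integrates to the error in [rho]. *)
assert (rho1 : forall s, 0 <= s <= s0 -> Rabs (rho s - R1 s) <= 0 + 2 * e1 * (s - 0)).
{ apply (angle_stability (fun s => cos (chi s)) (fun s => cos (X1 s)));
    [exact drho | exact is_derive_cat_rho | |].
  - rewrite rho_0, (proj2 X1_0), Rminus_0_r, Rabs_R0; lra.
  - intros s Hs; apply Rle_trans with (1 := cos_lipschitz _ _); now apply chi1. }
assert (rho2 : forall s, s0 <= s <= l ->
  Rabs (rho s - R2 s) <= (0 + 2 * e1 * (s0 - 0)) + 2 * e1 * (s - s0)).
{ apply (angle_stability (fun s => cos (chi s)) (fun s => cos (X2 s)));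
    [exact drho | apply is_derive_geo_rho | |].
  - unfold R2; rewrite <- R0; apply rho1; lra.
  - intros s Hs; apply Rle_trans with (1 := cos_lipschitz _ _); now apply chi2. }
set (kappa := fun s => c s + sin (chi s) * tanh (rho s)).
set (e2 := tau * B).
assert (e2E : e2 = e1 * (4 + 2 * l)) by (unfold e2, e1, B; ring).
assert (tau_e1 : tau <= e1) by (unfold e1; nra).
assert (kappa1 : forall s, 0 <= s <= s0 - tau ->
  Rabs (kappa s - 2 * / cosh s) <= e2).
{ intros s Hs; rewrite <- cat_curvature.
  replace (kappa s - _) with ((c0 s - cat_rate s) + (d +
    (sin (chi s) * tanh (rho s) - sin (X1 s) * tanh (R1 s))))
    by (unfold kappa, c, X1, R1; ring).
  apply Rle_trans with (tau + (e1 + (2 * e1 + (0 + 2 * e1 * (s - 0))))).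
  - apply Rabs_plus_le; [|apply Rabs_plus_le; [exact d_bound|]].
    + rewrite <- h1 by lra; apply close; [lra|]; rewrite Rabs_left1; lra.
    + apply Rle_trans with (1 := sin_tanh_lipschitz _ _ _ _).
      apply Rplus_le_compat; [apply chi1 | apply rho1]; lra.
  - rewrite e2E; nra. }
assert (kappa2 : forall s, s0 + tau <= s <= l -> Rabs (kappa s) <= e2).
{ intros s Hs.
  replace (kappa s) with ((c0 s - geo_rate A l s) + (d +
    (sin (chi s) * tanh (rho s) - sin (X2 s) * tanh (R2 s))))
    by (unfold kappa, c, geo_rate, X2, R2; ring).
  apply Rle_trans with
    (tau + (e1 + (2 * e1 + ((0 + 2 * e1 * (s0 - 0)) + 2 * e1 * (s - s0))))).
  - apply Rabs_plus_le; [|apply Rabs_plus_le; [exact d_bound|]].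
    + rewrite <- h2 by lra; apply close; [lra|]; rewrite Rabs_pos_eq; lra.
    + apply Rle_trans with (1 := sin_tanh_lipschitz _ _ _ _).
      apply Rplus_le_compat; [apply chi2 | apply rho2]; lra.
  - rewrite e2E; nra. }
assert (kappa_rough : forall s, Rabs (kappa s) <= 4).
{ intro s; assert (e1 <= 1) by (fold e2 in tauB; rewrite e2E in tauB; nra).
  apply Rle_trans with ((2 + 1) + 1 * 1); [|lra].
  apply Rabs_plus_le; [apply Rabs_plus_le; [apply c0_bound | lra]|].
  apply Rabs_mult_le; [apply Rabs_sin | apply tanh_bound]. }
assert (kappa_smooth : smooth1 (fun s => kappa s ^ 2)).
{ assert (S : smooth1 kappa).
  { apply smooth1_plus; [exact c_smooth|]; apply smooth1_mult.
    - now apply (smooth1_comp sin); [apply smooth1_sin|].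
    - now apply (smooth1_comp tanh); [apply smooth1_tanh|]. }
  apply (smooth1_ext (fun s => kappa s * kappa s)); [intro; ring|].
  now apply smooth1_mult. }
destruct (smooth1_antiderivative _ 0 0 kappa_smooth) as [K [dK [K_smooth K_0]]].
exists c, chi, rho.
split; [exact c_smooth|]; split; [intro; unfold c; now rewrite c0_even|].
split; [intro; unfold c; now rewrite c0_refl|]; split; [exact dchi|].
split; [unfold chi; rewrite X_0; ring|].
split; [unfold chi, d; field; lra|].
split; [exact drho|]; split; [exact rho_0|].
assert (RK : RInt (fun s => kappa s ^ 2) 0 l = K l).
{ apply is_RInt_unique; evar_last.
  - apply (is_RInt_derive K (fun s => kappa s ^ 2)); [intros; apply dK|].
    intros; now apply (smooth1_continuous (fun s => kappa s ^ 2)).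
  - unfold minus, plus, opp; simpl; rewrite K_0; ring. }
change (RInt _ 0 l) with (RInt (fun s => kappa s ^ 2) 0 l); rewrite RK.
assert (sq : forall u e, Rabs u <= e -> u ^ 2 <= e ^ 2).
{ intros u e Hu; apply Rabs_le_between in Hu; nra. }
assert (e2_pos : 0 <= e2) by (unfold e2; nra).
assert (lin : forall m s, is_derive (fun s => m * s) s m).
{ intros m s; auto_derive; [easy | ring]. }
(* The energy is estimated on three intervals. On the first, [kappa ^ 2] is at most
   [(2 / cosh s + e2) ^ 2], and [4 * tanh] is the primitive of the main term; the second is the
   window, the third the almost geodesic part. *)
assert (J1 := derive_le_increment K (fun s => 4 * tanh s + (4 * e2 + e2 ^ 2) * s)
  (fun s => kappa s ^ 2) (fun s => 4 * (/ cosh s) ^ 2 + (4 * e2 + e2 ^ 2))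
  0 (s0 - tau) ltac:(lra) (fun s _ => dK s)).
assert (J2 := derive_le_increment K (fun s => 4 ^ 2 * s)
  (fun s => kappa s ^ 2) (fun s => 4 ^ 2)
  (s0 - tau) (s0 + tau) ltac:(lra) (fun s _ => dK s) (fun s _ => lin _ s)
  (fun s _ => sq _ _ (kappa_rough s))).
assert (J3 := derive_le_increment K (fun s => e2 ^ 2 * s)
  (fun s => kappa s ^ 2) (fun s => e2 ^ 2)
  (s0 + tau) l ltac:(lra) (fun s _ => dK s) (fun s _ => lin _ s)
  (fun s H => sq _ _ (kappa2 s H))).
simpl in J1.
assert (J1' : K (s0 - tau) - K 0 <=
  4 * tanh (s0 - tau) + (4 * e2 + e2 ^ 2) * (s0 - tau) -
  (4 * tanh 0 + (4 * e2 + e2 ^ 2) * 0)).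
{ apply J1.
  - intros s _; apply (is_derive_plus (fun s => 4 * tanh s)
      (fun s => (4 * e2 + e2 ^ 2) * s)); [|apply lin].
    apply (is_derive_scal tanh), is_derive_tanh.
  - intros s Hs; generalize (kappa1 s Hs) (sech_bound s); intros W S.
    apply Rabs_le_between in W; nra. }
assert (tanh0 : tanh 0 = 0).
{ unfold tanh; rewrite sinh_0; unfold Rdiv; ring. }
assert (mono : tanh (s0 - tau) <= tanh s0).
{ generalize (derive_le_increment (fun _ => 0) tanh (fun _ => 0)
    (fun s => (/ cosh s) ^ 2) (s0 - tau) s0 ltac:(lra)
    (fun s _ => is_derive_const 0 s) (fun s _ => is_derive_tanh s)
    (fun s _ => pow2_ge_0 _)); lra. }
rewrite tanh0, K_0 in J1'; simpl in J2, J3.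
assert (e2 <= 1) by exact tauB.
assert (Q : e2 ^ 2 <= e2) by nra.
assert (M1 : (4 * e2 + e2 ^ 2) * (s0 - tau) + e2 ^ 2 * (l - (s0 + tau)) <= 6 * e2 * l).
{ assert (0 <= e2 ^ 2) by apply pow2_ge_0; nra. }
unfold gap, e2 in *; nra.
Qed.

(** * Assembling the torus *)

Theorem theorem4p5 (b : R) (hb : 1 <= b) :
  exists T : R * R -> R3,
    torus_of_revolution T /\
    is_conformal_class T (Ci * RtoC b)%C /\
    willmore_energy T < 8 * PI.
Proof.
(* The quarter length is long enough for a junction because [PI / 2 > 3 / 2] and [b >= 1]. *)
assert (Hl : 3 / 2 <= PI * b / 2) by (generalize PI2_3_2; nra).
destruct (smooth_rotation_rate _ Hl) as
  [c [chi [rho [c_smooth [c_even [c_refl [dchi [chi_0 [chi_l [drho [rho_0 J]]]]]]]]]]].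
destruct (torus_of_rotation_rate b c chi rho) as
  [x [q [Phi [k [Sx [Sq [SPhi [dx [dq [dPhi [Px [Pq E]]]]]]]]]]]]; auto; [lra | |].
{ intro s; rewrite <- (c_refl s); f_equal; field. }
exists (torus b x q); split; [|split].
- apply torus_of_revolution_torus with Phi; auto; lra.
- apply conformal_class_torus with Phi; auto; lra.
- rewrite (willmore_torus b x q Phi k) by (auto; lra).
  (* Four quarters of energy below 4, times [PI / 2]. *)
  rewrite E; generalize PI_RGT_0; nra.
Qed.
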